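(* Let $V$ be a finite vertex algebra which is simple. Then $V$ is commutative, i.e. $a_{(n)}b=0$ for all $a,b\in V$ and all $n\ge 0$.
   Context: All vector spaces are over $\mathbb{C}$. A vertex algebra is a vector space $V$ with a linear map $Y:V\to(\mathrm{End}\,V)[[z,z^{-1}]]$, written $Y(a,z)=\sum_{j\in\mathbb{Z}}a_{(j)}z^{-j-1}$, a vacuum element $\mathbf 1\in V$ and $T\in\mathrm{End}\,V$ such that for all $a,b\in V$: (field axiom) $a_{(j)}b=0$ for $j$ sufficiently large; (locality) $(z-w)^N[Y(a,z),Y(b,w)]=0$ for $N$ sufficiently large; (vacuum) $Y(\mathbf 1,z)=\mathrm{id}_V$ and $Y(a,z)\mathbf 1\equiv a \bmod zV[[z]]$; (translation invariance) $[T,Y(a,z)]=Y(Ta,z)=\frac{d}{dz}Y(a,z)$. $V$ is a $\mathbb{C}[T]$-module; $V$ is finite if it is a finitely generated $\mathbb{C}[T]$-module. For subsets $A,B\subset V$, $A\cdot B$ is the $\mathbb{C}$-span of all $a_{(j)}b$, $a\in A$, $b\in B$, $j\in\mathbb{Z}$. An ideal of $V$ is a $\mathbb{C}[T]$-submodule $I$ with $I\cdot V\subset I$. $V$ is simple if its only ideals are $0$ and $V$. *)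

(* Defs.v *)
From HB Require Import structures.
From mathcomp Require Import all_boot all_order all_algebra.
From mathcomp Require Import boolp classical_sets reals.
From mathcomp Require Import complex.

Set Implicit Arguments.
Unset Strict Implicit.
Unset Printing Implicit Defensive.

Import Order.TTheory GRing.Theory Num.Theory.
Local Open Scope classical_set_scope.
Local Open Scope ring_scope.

(* Formal distributions are stored by coefficients: a family f indexed by int
   stands for \sum_j f_j z^{-j-1}, and a family indexed by int * int for
   \sum_(m, n) f_{m, n} z^{-m-1} w^{-n-1}. Hence multiplying by z (resp. w)
   shifts the first (resp. second) index up by one. *)
Definition mul_zBw (V : zmodType) (f : int -> int -> V -> V) :
    int -> int -> V -> V :=
  fun m n c => f (m + 1) n c - f m (n + 1) c.

Definition fcomm (V : zmodType) (f g : int -> V -> V) : int -> int -> V -> V :=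
  fun m n c => f m (g n c) - g n (f m c).

(* C is modelled as R[i] for a realType R.  [va_prod a j b] is a_(j) b. *)
Record vertexAlgebra (R : realType) (V : lmodType R[i]) := VertexAlgebra {
  va_prod : V -> int -> {linear V -> V};
  va_vac : V;
  va_T : {linear V -> V};
  va_linear : forall (j : int) (b : V), linear (fun a => va_prod a j b);
  va_field : forall a b : V,
    exists N : int, forall j : int, N <= j -> va_prod a j b = 0;
  va_locality : forall a b : V, exists N0 : nat, forall N : nat, (N0 <= N)%N ->
    forall (m n : int) (c : V),
      iter N (@mul_zBw V) (fcomm (va_prod a) (va_prod b)) m n c = 0;
  va_vacL : forall (j : int) (b : V),
    va_prod va_vac j b = if j == -1 then b else 0;
  va_vacR : forall a : V, va_prod a (-1) va_vac = a;
  va_vacR0 : forall (a : V) (j : int), 0 <= j -> va_prod a j va_vac = 0;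
  va_Tcomm : forall (a : V) (j : int) (b : V),
    va_T (va_prod a j b) - va_prod a j (va_T b) = va_prod (va_T a) j b;
  va_Tderiv : forall (a : V) (j : int) (b : V),
    va_prod (va_T a) j b = (- j)%:~R *: va_prod a (j - 1) b
}.

(* The action p(T) v of p in C[T] on v. *)
Definition polyT (R : realType) (V : lmodType R[i]) (A : vertexAlgebra V)
    (p : {poly R[i]}) (v : V) : V :=
  \sum_(k < size p) p`_k *: iter k (va_T A) v.

Definition va_finite (R : realType) (V : lmodType R[i])
    (A : vertexAlgebra V) : Prop :=
  exists (n : nat) (g : 'I_n -> V), forall v : V,
    exists p : 'I_n -> {poly R[i]}, v = \sum_(i < n) polyT A (p i) (g i).

Definition va_submodule (R : realType) (V : lmodType R[i])
    (A : vertexAlgebra V) (I : set V) : Prop :=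
  [/\ I 0, forall x y, I x -> I y -> I (x + y)
    & forall (p : {poly R[i]}) (x : V), I x -> I (polyT A p x)].

Definition lin_span (K : nzRingType) (V : lmodType K) (X : set V) : set V :=
  [set v | exists (n : nat) (c : 'I_n -> K) (x : 'I_n -> V),
     (forall i, X (x i)) /\ v = \sum_(i < n) c i *: x i].

Definition va_dot (R : realType) (V : lmodType R[i])
    (A : vertexAlgebra V) (X Y : set V) : set V :=
  lin_span [set v | exists (a b : V) (j : int),
     [/\ X a, Y b & v = va_prod A a j b]].

Definition va_ideal (R : realType) (V : lmodType R[i])
    (A : vertexAlgebra V) (I : set V) : Prop :=
  va_submodule A I /\ va_dot A I setT `<=` I.

(* The zero vertex algebra is not excluded. *)
Definition va_simple (R : realType) (V : lmodType R[i])
    (A : vertexAlgebra V) : Prop :=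
  forall I : set V, va_ideal A I -> I = [set 0] \/ I = setT.

Definition va_commutative (R : realType) (V : lmodType R[i])
    (A : vertexAlgebra V) : Prop :=
  forall (a b : V) (n : int), 0 <= n -> va_prod A a n b = 0.

(* Main.v *)
Require Import Defs.
From HB Require Import structures.
From mathcomp Require Import all_boot all_order all_algebra.
From mathcomp Require Import boolp classical_sets reals.
From mathcomp Require Import complex.
From mathcomp Require Import zify ring.

(** Why a simple finite vertex algebra V is commutative.

    Write T for the translation operator.  Call a vector central if all its
    nonnegative modes vanish, and call the first nonvanishing nonnegative mode
    of any other vector its lowest mode.  The commutator formula
    [mode_commutator] shows that a lowest mode is a derivation of all products;
    it also commutes with T.

    Simplicity makes derivations rigid.  No nonzero vector is killed by all
    modes of a nonzero vector ([simple_mode_eq0]), so comparing top terms in the Leibniz rule shows that a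
    nilpotent derivation vanishes ([nilpotent_derivation_eq0]) and that two
    commuting derivations with d^s e^t = 0 cannot both be nonzero
    ([commuting_derivations_eq0]).

    Finiteness supplies nilpotency.  Every T-linear operator D satisfies a
    polynomial relation over C[T] ([operator_relation]).  If E = [D, X] commutes
    with D, then bracketing such a relation repeatedly with X strips it down to
    a(T) E^m = 0 ([leading_coef_commutator]); torsion vectors are central, so a
    lowest mode E of this form is nilpotent, hence zero.  Therefore lowest modes
    commute with each other ([low_abelian]).  The same device, applied to T
    itself and to the mode following a lowest mode, shows that every lowest
    mode is a scalar multiple of T ([lowest_mode_scalar]).

    If V is not commutative, it follows that V modulo central vectors is a free
    C[T]-module of rank one ([exists_coordinate]), and comparing degrees in T
    yields a vector L with L_(0) = T and L_(1) L = 2 L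
    ([exists_conformal_vector]).  For such an L the eigenspace of L_(1) of
    eigenvalue k + 2 is the line spanned by T^k L.  This is too small for the
    Virasoro algebra ([no_finite_virasoro]): L_(-1) L = a T^2 L,
    L_(-2) L = b T^3 L and L_(-3) L = c T^4 L, and applying L_(2) and L_(3) gives
    incompatible values of a, b and c.  The value of a forces the central charge
    -22/5 of the Lee-Yang minimal model, where lines no longer suffice in
    weight 6. *)

Set Implicit Arguments.
Unset Strict Implicit.
Unset Printing Implicit Defensive.

Import Order.TTheory GRing.Theory Num.Theory.
Local Open Scope ring_scope.

(** * Linear arithmetic in a module *)

Section LinearArith.

Variables (K : pzRingType) (V : lmodType K).

Inductive lexpr :=
  | LVar of nat | LZero | LAdd of lexpr & lexpr | LOpp of lexpr
  | LScale of K & lexpr | LMuln of lexpr & nat.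

Fixpoint leval (vs : seq V) e : V :=
  match e with
  | LVar i => vs`_i
  | LZero => 0
  | LAdd e1 e2 => leval vs e1 + leval vs e2
  | LOpp e1 => - leval vs e1
  | LScale a e1 => a *: leval vs e1
  | LMuln e1 n => leval vs e1 *+ n
  end.

Fixpoint lcoef e i : K :=
  match e with
  | LVar j => if eqn i j then 1 else 0
  | LZero => 0
  | LAdd e1 e2 => lcoef e1 i + lcoef e2 i
  | LOpp e1 => - lcoef e1 i
  | LScale a e1 => a * lcoef e1 i
  | LMuln e1 n => lcoef e1 i *+ n
  end.

Fixpoint lcoefs_eq n e1 e2 : Prop :=
  if n is n'.+1 then lcoefs_eq n' e1 e2 /\ lcoef e1 n' = lcoef e2 n' else True.

Lemma levalE vs e : leval vs e = \sum_(i < size vs) lcoef e i *: vs`_i.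
Proof.
elim: e => [j||e1 IH1 e2 IH2|e IH|a e IH|e IH n] /=; rewrite ?IH1 ?IH2 ?IH.
- have [ltj|lej] := ltnP j (size vs); last first.
    rewrite nth_default // big1 // => i _; case: eqnP => [ij|]; last by rewrite scale0r.
    by move: lej; rewrite -ij leqNgt ltn_ord.
  rewrite (bigD1 (Ordinal ltj)) //=; case: eqnP => // _; rewrite scale1r big1 ?addr0 // => i.
  by case: eqnP => [ij /eqP[]|_ _]; [apply: val_inj | rewrite scale0r].
- by rewrite big1 // => i _; rewrite scale0r.
- by rewrite -big_split; apply: eq_bigr => i _; rewrite scalerDl.
- by rewrite -sumrN; apply: eq_bigr => i _; rewrite scaleNr.
- by rewrite scaler_sumr; apply: eq_bigr => i _; rewrite scalerA.
- by rewrite -sumrMnl; apply: eq_bigr => i _; rewrite scalerMnl.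
Qed.

(** Two expressions with the same coefficients at each of the listed atoms have
    equal values; an index beyond the list denotes the zero vector. *)
Lemma leval_eq vs e1 e2 :
  lcoefs_eq (size vs) e1 e2 -> leval vs e1 = leval vs e2.
Proof.
move=> H; rewrite !levalE; apply: eq_bigr => i _; congr (_ *: _).
move: (nat_of_ord i) (ltn_ord i) => {i} i; elim: (size vs) H => //= n IH [/IH Hn En].
by rewrite ltnS leq_eqVlt => /orP[/eqP->|/Hn].
Qed.

End LinearArith.

(* Atoms are compared up to conversion: simplification may leave different but
   convertible structures on two occurrences of the same vector. *)
Ltac lmod_index x vs :=
  match vs with
  | ?y :: _ => let _ := match goal with _ => unify x y end in constr:(0%N)
  | _ :: ?r => let i := lmod_index x r in constr:(S i)
  end.

Ltac lmod_atoms t vs :=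
  match t with
  | (?a + ?b)%R => let vs1 := lmod_atoms a vs in lmod_atoms b vs1
  | (- ?a)%R => lmod_atoms a vs
  | (_ *: ?a)%R => lmod_atoms a vs
  | (?a *+ _)%R => lmod_atoms a vs
  | (GRing.zero)%R => vs
  | _ => match vs with
         | _ => let i := lmod_index t vs in vs
         | _ => constr:(t :: vs)
         end
  end.

Ltac lmod_reify K t vs :=
  match t with
  | (?a + ?b)%R => let ea := lmod_reify K a vs in let eb := lmod_reify K b vs in
                   constr:(@LAdd K ea eb)
  | (- ?a)%R => let ea := lmod_reify K a vs in constr:(@LOpp K ea)
  | (?k *: ?a)%R => let ea := lmod_reify K a vs in constr:(@LScale K k ea)
  | (?a *+ ?n)%R => let ea := lmod_reify K a vs in constr:(@LMuln K ea n)
  | (GRing.zero)%R => constr:(@LZero K)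
  | _ => let i := lmod_index t vs in constr:(@LVar K i)
  end.

(** Reduces an equation between linear combinations of vectors in a module V
    to the equations between the coefficients of each atom. *)
Ltac lmod_arith V :=
  lazymatch type of V with GRing.Lmodule.type ?K =>
  lazymatch goal with
  | |- ?l = ?r =>
    let vs1 := lmod_atoms l constr:(@nil V) in
    let vs := lmod_atoms r vs1 in
    let el := lmod_reify K l vs in
    let er := lmod_reify K r vs in
    refine (@leval_eq K V vs el er _); rewrite /lcoefs_eq /lcoef /=;
    repeat split
  end end.

(** * Locality of coefficient families *)

Section Locality.

Variables (K : comPzRingType) (V : lmodType K).

Lemma mul_zBwE (f : int -> int -> V -> V) m n c :
  mul_zBw f m n c = f (m + 1) n c - f m (n + 1) c.
Proof. by []. Qed.

Lemma mul_zBw_inj (f : int -> int -> V -> V) (c : V) (M : int) :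
  (forall m n, M <= n -> f m n c = 0) ->
  (forall m n, mul_zBw f m n c = 0) -> forall m n, f m n c = 0.
Proof.
move=> fM mulf0.
suff H (k : nat) m n : M - k%:Z <= n -> f m n c = 0.
  by move=> m n; apply: (H `|M - n|%N); lia.
elim: k m n => [|k IH] m n; first by rewrite subr0; exact: fM.
move=> le_n; have := mulf0 (m - 1) n; rewrite mul_zBwE subrK.
by rewrite (IH (m - 1) (n + 1)) ?subr0 //; lia.
Qed.

(** On families bounded in the second index the factor z - w is invertible, so
    locality turns into genuine commutation. *)
Lemma iter_mul_zBw_inj (f : int -> int -> V -> V) (c : V) (M : int) N :
  (forall m n, M <= n -> f m n c = 0) ->
  (forall m n, iter N (@mul_zBw V) f m n c = 0) -> forall m n, f m n c = 0.
Proof.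
elim: N f => [|N IH] f fM; first by [].
rewrite iterSr => f0; apply: (mul_zBw_inj fM); apply: IH f0 => m n le_n.
by rewrite mul_zBwE !fM ?subr0 //; lia.
Qed.

Lemma iter_mul_zBw_fcomm_pair (f g : int -> V -> V) N m n c :
  iter N (@mul_zBw V) (fcomm f g) m n c =
    iter N (@mul_zBw V) (fun m n c => f m (g n c)) m n c
    - iter N (@mul_zBw V) (fun m n c => g n (f m c)) m n c.
Proof.
elim: N m n => [|N IH] m n //=; rewrite !mul_zBwE !IH.
by lmod_arith V; ring.
Qed.

(** Evaluated in w-degree zero on a family without negative powers of w, the
    factor (z - w)^N reduces to z^N. *)
Lemma iter_mul_zBw_edge (f : int -> int -> V -> V) (c : V) N m :
  (forall m n, 0 <= n -> f m n c = 0) ->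
  iter N (@mul_zBw V) f m (-1) c = f (m + N%:Z) (-1) c.
Proof.
move=> f0; have it0 k m' n : 0 <= n -> iter k (@mul_zBw V) f m' n c = 0.
  elim: k m' n => [|k IH] m' n n0 /=; first exact: f0.
  by rewrite mul_zBwE !IH ?subr0 //; lia.
elim: N m => [|N IH] m; first by rewrite addr0.
by rewrite iterS mul_zBwE IH it0 ?subr0 //; congr f; lia.
Qed.

Lemma iter_mul_zBw_closed (I : V -> Prop) (f : int -> int -> V -> V) c N :
  (forall x y, I x -> I y -> I (x - y)) -> (forall m n, I (f m n c)) ->
  forall m n, I (iter N (@mul_zBw V) f m n c).
Proof.
by move=> IB If; elim: N => [|N IH] m n //=; rewrite mul_zBwE; apply: IB.
Qed.

Lemma iter_mul_zBw_shift (f : int -> int -> V -> V) (h : int) N m n c :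
  iter N (@mul_zBw V) (fun m n => f (m + h) n) m n c =
    iter N (@mul_zBw V) f (m + h) n c.
Proof.
elim: N m n => [|N IH] m n //=; rewrite !mul_zBwE !IH.
by rewrite addrAC.
Qed.

Lemma iter_mul_zBw_add (f g : int -> int -> V -> V) N m n c :
  iter N (@mul_zBw V) (fun m n c => f m n c + g m n c) m n c =
    iter N (@mul_zBw V) f m n c + iter N (@mul_zBw V) g m n c.
Proof.
elim: N m n => [|N IH] m n //=; rewrite !mul_zBwE !IH.
by rewrite opprD addrACA.
Qed.

Definition local_fields (f g : int -> V -> V) :=
  exists N0 : nat, forall N, (N0 <= N)%N ->
    forall m n c, iter N (@mul_zBw V) (fcomm f g) m n c = 0.

Lemma iter_mul_zBw_ext (f g : int -> int -> V -> V) N m n c :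
  (forall m n, f m n c = g m n c) ->
  iter N (@mul_zBw V) f m n c = iter N (@mul_zBw V) g m n c.
Proof.
move=> fg; elim: N m n => [|N IH] m n /=; first exact: fg.
by rewrite mul_zBwE !IH.
Qed.

Lemma local_fieldsD (f1 f2 g : int -> V -> V) :
  (forall n, {morph g n : x y / x + y}) ->
  local_fields f1 g -> local_fields f2 g ->
  local_fields (fun n c => f1 n c + f2 n c) g.
Proof.
move=> gD [N1 H1] [N2 H2]; exists (maxn N1 N2) => N.
rewrite geq_max => /andP[leN1 leN2] m n c.
rewrite (@iter_mul_zBw_ext _
  (fun m n c => fcomm f1 g m n c + fcomm f2 g m n c)); last first.
  by move=> m' n'; rewrite /fcomm gD opprD addrACA.
by rewrite iter_mul_zBw_add H1 // H2 // addr0.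
Qed.

Lemma local_fields_shift (f g : int -> V -> V) (h : int) :
  local_fields f g -> local_fields (fun n => f (n + h)) g.
Proof.
move=> [N0 H]; exists N0 => N leN m n c.
exact: etrans (iter_mul_zBw_shift (fcomm f g) h N m n c) (H N leN _ _ c).
Qed.

End Locality.

Section Dong.

Variables (K : comPzRingType) (V : lmodType K).

(* Coefficient families in three variables z, w, u; P, Q and S are
   multiplication by z - w, z - u and w - u. *)
Let fam := int -> int -> int -> V.
Let P (F : fam) : fam := fun m n l => F (m + 1) n l - F m (n + 1) l.
Let Q (F : fam) : fam := fun m n l => F (m + 1) n l - F m n (l + 1).
Let S (F : fam) : fam := fun m n l => F m (n + 1) l - F m n (l + 1).
Let Z (F : fam) := forall m n l, F m n l = 0.
Let sub (F G : fam) : fam := fun m n l => F m n l - G m n l.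

Let opB (O : fam -> fam) := forall F G, O (sub F G) = sub (O F) (O G).

Let BB (a b c d : V) : (a - b) - (c - d) = (a - c) - (b - d).
Proof. by lmod_arith V; ring. Qed.

Let QB : opB Q.
Proof. by move=> F G; apply/funext=> m; apply/funext=> n; apply/funext=> l; exact: BB. Qed.
Let SB : opB S.
Proof. by move=> F G; apply/funext=> m; apply/funext=> n; apply/funext=> l; exact: BB. Qed.

Let iterB (O : fam -> fam) N : opB O -> opB (iter N O).
Proof. by move=> OB F G; elim: N => //= N ->; exact: OB. Qed.

Let iterC (O O' : fam -> fam) N : (forall F, O (O' F) = O' (O F)) ->
  forall F, iter N O (O' F) = O' (iter N O F).
Proof. by move=> OO F; elim: N => //= N ->. Qed.

Let PQ F : P (Q F) = Q (P F).
Proof. by apply/funext=> m; apply/funext=> n; apply/funext=> l; exact: BB. Qed.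
Let PS F : P (S F) = S (P F).
Proof. by apply/funext=> m; apply/funext=> n; apply/funext=> l; exact: BB. Qed.
Let QS F : Q (S F) = S (Q F).
Proof. by apply/funext=> m; apply/funext=> n; apply/funext=> l; exact: BB. Qed.

Let SQP F : S F = sub (Q F) (P F).
Proof.
apply/funext=> m; apply/funext=> n; apply/funext=> l; rewrite /sub /S /Q /P.
by lmod_arith V; ring.
Qed.

Let Ziter (O : fam -> fam) N F : (forall F, Z F -> Z (O F)) -> Z F -> Z (iter N O F).
Proof. by move=> ZO ZF; elim: N => //= N /ZO. Qed.

Let ZS F : Z F -> Z (S F).
Proof. by move=> ZF m n l; rewrite /S !ZF subrr. Qed.
Let ZP F : Z F -> Z (P F).
Proof. by move=> ZF m n l; rewrite /P !ZF subrr. Qed.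
Let ZQ F : Z F -> Z (Q F).
Proof. by move=> ZF m n l; rewrite /Q !ZF subrr. Qed.

(** The algebra behind Dong's lemma: w - u = (z - u) - (z - w), so a power of
    w - u lies in the ideal generated by (z - w)^a and (z - u)^b (w - u)^c. *)
Let dong_ideal a b c F : Z (iter a P F) -> Z (iter b Q (iter c S F)) ->
  Z (iter (a + b + c) S F).
Proof.
move Ds: (a + b)%N => s; elim: s a b F Ds => [|s IH] a b F Ds.
  have [-> ->] : a = 0%N /\ b = 0%N by lia.
  by [].
case: a Ds => [|a] Ds.
  by move=> ZF _; exact: Ziter ZS ZF.
case: b Ds => [|b] Ds.
  move=> _ ZF; rewrite iterD; exact: Ziter ZS ZF.
move=> ZPF ZQF; rewrite addSn iterSr SQP iterB; last exact: SB.
have ZQ' : Z (iter (s + c) S (Q F)).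
  apply: (IH a.+1 b); first by lia.
    by rewrite iterC; [exact: ZQ | exact: PQ].
  have -> : iter c S (Q F) = Q (iter c S F) by apply: iterC => G; rewrite QS.
  by rewrite -iterSr.
have ZP' : Z (iter (s + c) S (P F)).
  apply: (IH a b.+1); first by lia.
    by rewrite -iterSr.
  have -> : iter c S (P F) = P (iter c S F) by apply: iterC => G; rewrite PS.
  rewrite iterC; first exact: ZP.
  by move=> G; rewrite PQ.
by move=> m n l; rewrite /sub ZQ' ZP' subrr.
Qed.

(** Dong's lemma for one mode of the first field.  The triple bracket of f, g
    and h is killed by a power of z - w, and, by the Jacobi identity, by a
    power of z - u times a power of w - u. *)
Lemma local_fields_bracket (f g h : int -> V -> V) (m : int) :
  (forall n, {morph f n : x y / x - y}) ->
  (forall n, {morph g n : x y / x - y}) ->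
  (forall n, {morph h n : x y / x - y}) ->
  local_fields f g -> local_fields f h -> local_fields g h ->
  local_fields (fun n => fcomm f g m n) h.
Proof.
move=> fB gB hB [Nfg Hfg] [Nfh Hfh] [Ngh Hgh].
pose F c : fam := fun m n l => fcomm (fun n => fcomm f g m n) h n l c.
pose F1 c : fam := fun m n l => f m (fcomm g h n l c) - fcomm g h n l (f m c).
pose F2 c : fam := fun m n l => g n (fcomm f h m l c) - fcomm f h m l (g n c).
have FE c : F c = sub (F1 c) (F2 c).
  apply/funext=> m'; apply/funext=> n; apply/funext=> l.
  rewrite /F /sub /F1 /F2 /fcomm fB gB hB.
  by lmod_arith V; ring.
have PFE N c m' n l : iter N P (F c) m' n l =
    iter N (@mul_zBw V) (fcomm f g) m' n (h l c)
    - h l (iter N (@mul_zBw V) (fcomm f g) m' n c).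
  elim: N m' n l => [|N IH] m' n l //=; rewrite /P !IH !mul_zBwE hB.
  by lmod_arith V; ring.
have SF1E N c m' n l : iter N S (F1 c) m' n l =
    f m' (iter N (@mul_zBw V) (fcomm g h) n l c)
    - iter N (@mul_zBw V) (fcomm g h) n l (f m' c).
  elim: N m' n l => [|N IH] m' n l //=; rewrite /S !IH !mul_zBwE fB.
  by lmod_arith V; ring.
have QF2E N c m' n l : iter N Q (F2 c) m' n l =
    g n (iter N (@mul_zBw V) (fcomm f h) m' l c)
    - iter N (@mul_zBw V) (fcomm f h) m' l (g n c).
  elim: N m' n l => [|N IH] m' n l //=; rewrite /Q !IH !mul_zBwE gB.
  by lmod_arith V; ring.
have mor0 (u : V -> V) : {morph u : x y / x - y} -> u 0 = 0.
  by move=> uB; have := uB 0 0; rewrite !subrr.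
have ZF c : Z (iter (Nfg + Nfh + Ngh) S (F c)).
  apply: dong_ideal => [m' n l|].
    by rewrite PFE !Hfg // (mor0 (h l)) // subr0.
  rewrite FE (iterB _ SB) (iterB _ QB) => m' n l; rewrite /sub.
  rewrite (Ziter _ ZQ); last by move=> m1 n1 l1; rewrite SF1E !Hgh // (mor0 (f m1)) // subr0.
  rewrite iterC; last by move=> G; rewrite [RHS]iterC // => G'; rewrite QS.
  rewrite (Ziter _ ZS) ?subr0 // => m1 n1 l1.
  by rewrite QF2E !Hfh // (mor0 (g n1)) // subr0.
exists (Nfg + Nfh + Ngh)%N => N leN n l c.
suff <- : iter N S (F c) m n l =
    iter N (@mul_zBw V) (fcomm (fun n => fcomm f g m n) h) n l c.
  by rewrite -(subnK leN) iterD; exact: Ziter ZS (ZF c) _ _ _.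
elim: N {leN} n l => [|N IH] n l //=.
by rewrite /S !IH.
Qed.

End Dong.

(** * Modes of a vertex algebra *)

Section Modes.

Variables (R : realType) (V : lmodType R[i]) (A : vertexAlgebra V).

Local Notation K := R[i].
Local Notation Y := (va_prod A).
Local Notation T := (va_T A).
Local Notation vac := (va_vac A).

Lemma modeDl a b j c : Y (a + b) j c = Y a j c + Y b j c.
Proof. by have := va_linear A j c 1 a b; rewrite !scale1r. Qed.

Lemma mode0l j c : Y 0 j c = 0.
Proof. by apply: (@addIr _ (Y 0 j c)); rewrite -modeDl !add0r. Qed.

Lemma modeZl k a j c : Y (k *: a) j c = k *: Y a j c.
Proof. by have := va_linear A j c k a 0; rewrite mode0l !addr0. Qed.

Lemma modeNl a j c : Y (- a) j c = - Y a j c.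
Proof. by rewrite -scaleN1r modeZl scaleN1r. Qed.

Lemma modeBl a b j c : Y (a - b) j c = Y a j c - Y b j c.
Proof. by rewrite modeDl modeNl. Qed.

Lemma mode_suml (I : Type) (r : seq I) (P : pred I) (F : I -> V) j c :
  Y (\sum_(i <- r | P i) F i) j c = \sum_(i <- r | P i) Y (F i) j c.
Proof.
by elim/big_rec2: _ => [|i y x _ <-]; rewrite ?mode0l ?modeDl.
Qed.

Lemma mode_Tl a (j : int) b : Y (T a) j b = (- j)%:~R *: Y a (j - 1) b.
Proof. exact: va_Tderiv. Qed.

Lemma T_mode a j b : T (Y a j b) = Y a j (T b) + Y (T a) j b.
Proof. by rewrite -va_Tcomm addrCA subrr addr0. Qed.

Lemma mode_Tr a (j : int) b : Y a j (T b) = T (Y a j b) + j%:~R *: Y a (j - 1) b.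
Proof. by rewrite T_mode mode_Tl mulrNz scaleNr addrNK. Qed.

Lemma mode_local a b : local_fields (Y a) (Y b).
Proof. exact: va_locality. Qed.

Lemma T_vac : T vac = 0.
Proof. by rewrite -(va_vacR A (T vac)) mode_Tl va_vacL /= scaler0. Qed.

(** Locality moves Y(c, u) across f; as f kills the vacuum, a power of w - u kills
    f(w) Y(c, u) 1, and setting u = 0 leaves f(w) c = 0. *)
Lemma local_vacuum_eq0 (f : int -> V -> V) :
  (forall n, {morph f n : x y / x - y}) ->
  (forall c, local_fields f (Y c)) ->
  (forall n, f n vac = 0) -> forall n c, f n c = 0.
Proof.
move=> fB floc fvac n c; have [N /(_ N (leqnn N)) H] := floc c.
have f0 m : f m 0 = 0 by have := fB m 0 0; rewrite !subrr.
have := @iter_mul_zBw_inj K V (fcomm f (Y c)) vac 0 N _ (fun m n => H m n vac) n (-1).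
rewrite /fcomm fvac linear0 subr0 va_vacR; apply => m' n' n'0.
by rewrite va_vacR0 // fvac f0 linear0 subrr.
Qed.

Section Commutator.

Variables a b : V.

(* The defect of the commutator formula.  The coefficients are absorbed into the
   vectors, so that each summand is a shifted field. *)
Let D (m : nat) (n : int) (c : V) : V := fcomm (Y a) (Y b) m n c
  + \sum_(j < m.+1) Y ((- 'C(m, j)%:R) *: Y a j b) (n + (m%:Z - j%:Z)) c.

Let DB m n : {morph D m n : x y / x - y}.
Proof.
move=> x y; rewrite /D /fcomm !linearB /=.
under eq_bigr do rewrite linearB /=.
by rewrite sumrB; lmod_arith V; ring.
Qed.

Let D_local m c : local_fields (D m) (Y c).
Proof.
have YB x n : {morph Y x n : y z / y - z} by move=> y z; rewrite linearB.
have YD x n : {morph Y x n : y z / y + z} by move=> y z; rewrite linearD.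
apply: (@local_fieldsD K V) => //.
  by apply: (@local_fields_bracket K V) => //; exact: mode_local.
elim: (m.+1) => [|k IH].
  exists 0%N => N _ m' n x; rewrite (@iter_mul_zBw_ext K V _ (fun _ _ => id \- id)) /=; last first.
    by move=> m1 n1; rewrite /fcomm !big_ord0 linear0 !subrr.
  elim: N m' n => [|N IH] m' n; first by rewrite /= subrr.
  by rewrite iterS mul_zBwE !IH subr0.
have := local_fieldsD (YD c) IH (local_fields_shift (m%:Z - k%:Z)
  (mode_local ((- 'C(m, k)%:R) *: Y a k b) c)).
move=> [N0 H]; exists N0 => N leN m' n x; rewrite -[RHS](H N leN m' n x).
by apply: (@iter_mul_zBw_ext K V) => m1 n1; rewrite /fcomm !big_ord_recr.
Qed.

(* Translation covariance of the defect moves the vacuum identity from the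
   mode n to the mode n - 1. *)
Let T_D m n c : T (D m n c) = D m n (T c) - n%:~R *: D m (n - 1) c
  - (if m is m'.+1 then m%:R *: D m' n c else 0).
Proof.
have Tf x y (i j : int) : T (Y x i (Y y j c)) =
    Y x i (Y y j (T c)) - j%:~R *: Y x i (Y y (j - 1) c)
    - i%:~R *: Y x (i - 1) (Y y j c).
  rewrite T_mode T_mode !mode_Tl linearD /= linearZ /= !mulrNz !scaleNr.
  by lmod_arith V; ring.
rewrite /D linearD raddf_sum /=.
have -> : T (fcomm (Y a) (Y b) m n c) = fcomm (Y a) (Y b) m n (T c)
   - n%:~R *: fcomm (Y a) (Y b) m (n - 1) c
   - m%:R *: fcomm (Y a) (Y b) (m%:Z - 1) n c.
  by rewrite /fcomm linearB /= !Tf -!pmulrn; lmod_arith V; ring.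
have E j : T (Y ((- 'C(m, j)%:R) *: Y a j b) (n + (m%:Z - j%:Z)) c) =
    Y ((- 'C(m, j)%:R) *: Y a j b) (n + (m%:Z - j%:Z)) (T c)
    - n%:~R *: Y ((- 'C(m, j)%:R) *: Y a j b) (n - 1 + (m%:Z - j%:Z)) c
    - ((m%:R - j%:R) * (- 'C(m, j)%:R)) *: Y (Y a j b) (n - 1 + (m%:Z - j%:Z)) c.
  rewrite T_mode mode_Tl !modeZl (_ : n + (m%:Z - j%:Z) - 1 = n - 1 + (m%:Z - j%:Z)); last by lia.
  rewrite mulrNz !intrD mulrNz -!pmulrn.
  by lmod_arith V; ring.
under eq_bigr => j _ do rewrite E.
rewrite !sumrB -scaler_sumr.
case: m {E} => [|m].
  rewrite !big_ord1 /=.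
  by lmod_arith V; ring.
rewrite [X in _ + (_ - X) = _](_ : _ = m.+1%:R *: \sum_(j < m.+1)
   Y ((- 'C(m, j)%:R) *: Y a j b) (n + (m%:Z - j%:Z)) c); last first.
  rewrite big_ord_recr /= subrr mul0r scale0r addr0 scaler_sumr.
  apply: eq_bigr => j _; have lej : (j <= m)%N by rewrite -ltnS.
  rewrite modeZl (_ : n - 1 + (m.+1%:Z - j%:Z) = n + (m%:Z - j%:Z)); last by lia.
  rewrite scalerA !mulrN -natrB ?leqW //.
  by rewrite -!natrM -(mul_bin_down m.+1).
rewrite (_ : m.+1%:Z - 1 = m%:Z); last by lia.
by lmod_arith V; ring.
Qed.

Let D_vac m n : D m n vac = 0.
Proof.
have [n0|n0] := leP 0 n.
  rewrite /D /fcomm !va_vacR0 // !linear0 !add0r big1 // => j _.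
  by rewrite va_vacR0 //; have := ltn_ord j; lia.
suff H (i : nat) m' : D m' (- 1 - i%:Z) vac = 0 by rewrite -(H (absz (n + 1)) m); congr D; lia.
elim: i m' => [|i IH] m'.
  rewrite subr0 /D /fcomm va_vacR va_vacR0 // linear0 subr0 big_ord_recr /= big1 ?add0r.
    by rewrite binn subrr addr0 va_vacR scaleN1r subrr.
  by move=> j _; rewrite va_vacR0 //; have := ltn_ord j; lia.
have := T_D m' (-1 - i%:Z) vac; rewrite IH T_vac linear0.
have D0 : D m' (-1 - i%:Z) 0 = 0 by have := DB m' (-1 - i%:Z) 0 0; rewrite !subrr.
rewrite D0 sub0r; have -> : (if m' is m''.+1 then m'%:R *: D m'' (-1 - i%:Z) vac else 0) = 0.
  by case: m' {D0} => // m'; rewrite IH scaler0.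
rewrite subr0 => /esym/eqP; rewrite oppr_eq0 scaler_eq0 intr_eq0.
case/orP => [|/eqP <-]; first by lia.
by congr D; lia.
Qed.

(** Borcherds' commutator formula.  Both sides are local with respect to all
    fields, by Dong's lemma on the left, and they agree on the vacuum. *)
Lemma mode_commutator (m : nat) (n : int) c :
  Y a m (Y b n c) = Y b n (Y a m c)
    + \sum_(j < m.+1) 'C(m, j)%:R *: Y (Y a j b) (n + (m%:Z - j%:Z)) c.
Proof.
have := local_vacuum_eq0 (DB m) (D_local m) (D_vac m) n c.
rewrite /D /fcomm => /eqP; rewrite addrAC subr_eq0 => /eqP <-.
rewrite -addrA -big_split big1 ?addr0 // => j _.
by rewrite /= modeZl scaleNr addNr.
Qed.

End Commutator.

Lemma mode_vac_eq0 c : (forall n, Y c n vac = 0) -> c = 0.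
Proof. by move=> /(_ (-1)); rewrite va_vacR. Qed.

Lemma T_mode_nat_succ a (n : nat) b : Y (T a) n.+1 b = - (n.+1%:R *: Y a n b).
Proof. by rewrite mode_Tl mulrNz scaleNr -pmulrn (_ : n.+1%:Z - 1 = n) //; lia. Qed.

Lemma T_mode_nat0 a b : Y (T a) 0 b = 0.
Proof. by rewrite mode_Tl oppr0 scale0r. Qed.

(** The part of skew-symmetry that does not depend on its explicit form: the
    modes of a on b are combinations of modes of b on modes of a at the
    vacuum. *)
Lemma mode_swap_closed (I : V -> Prop) a b :
  (forall x y, I x -> I y -> I (x - y)) ->
  (forall m n, I (Y b n (Y a m vac))) -> forall n, I (Y a n b).
Proof.
move=> IB Iba n; have [N /(_ N (leqnn N)) H] := mode_local a b.
have := H (n - N%:Z) (-1) vac; rewrite (@iter_mul_zBw_fcomm_pair K V).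
rewrite iter_mul_zBw_edge => [|m' n' n'0]; last by rewrite va_vacR0 // linear0.
rewrite va_vacR subrK => /eqP; rewrite subr_eq0 => /eqP ->.
exact: (@iter_mul_zBw_closed K V).
Qed.

Definition central (v : V) := forall (n : nat) w, Y v n w = 0.

(** A central b has no poles, so the locality relation on the vacuum retains a
    single term. *)
Lemma mode_central a b n : central b -> Y a n b = Y b (-1) (Y a n vac).
Proof.
move=> cb; have [N /(_ N (leqnn N)) H] := mode_local a b.
have := H (n - N%:Z) (-1) vac; rewrite (@iter_mul_zBw_fcomm_pair K V).
rewrite iter_mul_zBw_edge => [|m' n' n'0]; last by rewrite va_vacR0 // linear0.
rewrite iter_mul_zBw_edge => [|m' n' n'0]; last by case: n' n'0 => // n' _; exact: cb.
by rewrite va_vacR subrK => /eqP; rewrite subr_eq0 => /eqP ->.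
Qed.

Lemma mode_central0 a b (n : nat) : central b -> Y a n b = 0.
Proof. by move=> cb; rewrite mode_central // va_vacR0 // linear0. Qed.

Lemma centralZ k a : central a -> central (k *: a).
Proof. by move=> ca n w; rewrite modeZl ca scaler0. Qed.

Lemma central0 : central 0.
Proof. by move=> n w; rewrite mode0l. Qed.

Lemma mode_nat_bounded a b : exists N : nat, forall n : nat, (N <= n)%N -> Y a n b = 0.
Proof.
have [N H] := va_field A a b; exists (absz N) => n leN; apply: H; lia.
Qed.

Lemma mode_iterT a (i n : nat) b :
  Y (iter i T a) n b = if (i <= n)%N then (-1) ^+ i *: ((n ^_ i)%:R *: Y a (n - i)%N b) else 0.
Proof.
elim: i n => [|i IH] n; first by rewrite subn0 ffactn0 expr0 !scale1r.
case: n => [|n]; first by rewrite T_mode_nat0.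
rewrite iterS T_mode_nat_succ IH ltnS subSS; case: ifP => _; last by rewrite scaler0 oppr0.
by rewrite ffactnS /= exprS natrM !scalerA mulN1r -scaleNr; congr (_ *: _); ring.
Qed.

(** A vector killed by p(T) has fields annihilated by p(d/dz); such fields have
    no pole because differentiation strictly increases the order of a pole. *)
Lemma torsion_central (p : {poly K}) v : p != 0 -> polyT A p v = 0 -> central v.
Proof.
(* Descending induction on n: the mode n + d of p(T) v, where d is the degree
   of p, sees v_(n) only through the leading coefficient. *)
move=> p0 pv n w; have [N HN] := mode_nat_bounded v w.
suff H k : (N - k <= n)%N -> Y v n w = 0 by apply: (H N); rewrite subnn.
elim: k n => [|k IH] n; first by rewrite subn0; exact: HN.
move=> len; set d := (size p).-1.
have := congr1 (fun u => Y u (n + d)%N w) pv; rewrite /polyT mode_suml mode0l.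
have sp : size p = d.+1 by rewrite /d prednK // size_poly_gt0.
rewrite sp big_ord_recr /= big1 => [|i _].
  rewrite add0r modeZl mode_iterT leq_addl addnK => /eqP.
  rewrite !scalerA scaler_eq0 => /orP[|/eqP->//].
  rewrite !mulf_eq0 signr_eq0 pnatr_eq0 orbF -/(lead_coef p) lead_coef_eq0 (negPf p0) /=.
  by rewrite -leqn0 leqNgt ffact_gt0 leq_addl.
have ltid := ltn_ord i.
rewrite modeZl mode_iterT; case: ifP => _; last by rewrite scaler0.
by rewrite IH ?scaler0 //; lia.
Qed.

Section Simple.

Hypothesis simpleA : va_simple A.

(** By locality the vectors annihilated by all modes of a form an ideal. *)
Lemma simple_mode_eq0 a x : (forall n, Y a n x = 0) -> a = 0 \/ x = 0.
Proof.
move=> ax; pose I := [set y | forall n, Y a n y = 0]%classic.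
have IB y z : I y -> I z -> I (y - z) by move=> Iy Iz n; rewrite linearB /= Iy Iz subrr.
have IZ k y : I y -> I (k *: y) by move=> Iy n; rewrite linearZ /= Iy scaler0.
have I0 : I 0 by move=> n; rewrite linear0.
have IN y : I y -> I (- y) by move=> Iy; rewrite -[- y]sub0r; apply: IB.
have ID y z : I y -> I z -> I (y + z) by move=> Iy Iz; rewrite -[z]opprK; apply: IB => //; apply: IN.
have IT y : I y -> I (T y) by move=> Iy n; rewrite mode_Tr !Iy linear0 scaler0 addr0.
have Imode c m y : I y -> I (Y c m y).
  move=> Iy n; have [M HM] := va_field A c y.
  have [N /(_ N (leqnn N)) H] := mode_local a c.
  have := @iter_mul_zBw_inj K V (fcomm (Y a) (Y c)) y M N _ (fun m n => H m n y) n m.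
  rewrite /fcomm Iy linear0 subr0; apply => m' n' leM.
  by rewrite HM // linear0 Iy linear0 subrr.
have Isum (J : Type) (r : seq J) (F : J -> V) : (forall i, I (F i)) -> I (\sum_(i <- r) F i).
  by move=> IF; elim/big_rec: _ => // i y _; apply: ID.
have ideal : va_ideal A I.
  split; first split => // p y Iy.
    by apply: Isum => i; apply: IZ; elim: (nat_of_ord i) => //= k; apply: IT.
  move=> v [n [c [y [Hy ->]]]]; apply: Isum => i; apply: (IZ).
  (* The set I is stable under left modes; products with I on the left are
     reached through modes of z on T-derivatives of y1. *)
  have [y1 [z [j [Iy1 _ ->]]]] := Hy i.
  apply: mode_swap_closed IB _ j => m k; apply: Imode.
  have [m0|m0] := leP 0 m; first by rewrite va_vacR0.
  suff H (l : nat) : I (Y y1 (-1 - l%:Z) vac).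
    by have := H (absz (m + 1)); congr (I (Y _ _ _)); lia.
  elim: l => [|l IH]; first by rewrite va_vacR.
  have := IT _ IH; rewrite T_mode T_vac linear0 add0r mode_Tl.
  set k1 := (- _)%:~R; have k10 : k1 != 0 by rewrite intr_eq0; lia.
  move=> /(IZ k1^-1); rewrite scalerA mulVf // scale1r.
  by congr (I (Y _ _ _)); lia.
have [I_0|IT_] := simpleA ideal; [right | left].
  by have : I x := ax; rewrite I_0.
by apply: mode_vac_eq0; have : I vac by rewrite IT_.
Qed.

End Simple.

End Modes.

(** * Polynomials in an endomorphism *)

Section PolyEval.

Variables (K : comNzRingType) (V : lmodType K).
Implicit Types (f : {linear V -> V}) (p q : {poly K}).

Definition peval (f : V -> V) p v := \sum_(k < size p) p`_k *: iter k f v.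

Lemma iter_linear f n : linear (iter n f).
Proof. by elim: n => // n IH k u v; rewrite /= IH linearP. Qed.

Lemma iter0 f n : iter n f 0 = 0.
Proof. by elim: n => //= n ->; rewrite linear0. Qed.

Lemma iterZ f n k v : iter n f (k *: v) = k *: iter n f v.
Proof. by have := iter_linear f n k v 0; rewrite iter0 !addr0. Qed.

Lemma iterD_lin f n u v : iter n f (u + v) = iter n f u + iter n f v.
Proof. by have := iter_linear f n 1 u v; rewrite !scale1r. Qed.

Lemma iter_sum f n (I : Type) (r : seq I) (F : I -> V) :
  iter n f (\sum_(i <- r) F i) = \sum_(i <- r) iter n f (F i).
Proof. by elim/big_rec2: _ => [|i y x _ <-]; rewrite ?iter0 ?iterD_lin. Qed.

Lemma peval_wide f n p v : (size p <= n)%N ->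
  peval f p v = \sum_(k < n) p`_k *: iter k f v.
Proof.
move=> le_n; rewrite /peval (big_ord_widen _ (fun k => p`_k *: iter k f v) le_n) big_mkcond.
by apply: eq_bigr => i _; case: ltnP => // /(nth_default 0) ->; rewrite scale0r.
Qed.

Lemma peval_linear f p : linear (peval f p).
Proof.
move=> k u v; rewrite /peval scaler_sumr -big_split; apply: eq_bigr => i _ /=.
by rewrite iter_linear scalerDr !scalerA mulrC.
Qed.

HB.instance Definition _ f p :=
  GRing.isLinear.Build K V V _ (peval f p) (peval_linear f p).

Lemma peval_lin0 f p : peval f p 0 = 0.
Proof. by rewrite /peval big1 // => i _; rewrite iter0 scaler0. Qed.

Lemma peval_linD f p u v : peval f p (u + v) = peval f p u + peval f p v.
Proof. by have := peval_linear f p 1 u v; rewrite !scale1r. Qed.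

Lemma peval_lin_sum f p (I : Type) (r : seq I) (F : I -> V) :
  peval f p (\sum_(i <- r) F i) = \sum_(i <- r) peval f p (F i).
Proof. by elim/big_rec2: _ => [|i y x _ <-]; rewrite ?peval_lin0 ?peval_linD. Qed.

Lemma peval0 f v : peval f 0 v = 0.
Proof. by rewrite /peval size_poly0 big_ord0. Qed.

Lemma pevalD f p q v : peval f (p + q) v = peval f p v + peval f q v.
Proof.
rewrite (@peval_wide f (maxn (size p) (size q)) p) ?leq_maxl //.
rewrite (@peval_wide f (maxn (size p) (size q)) q) ?leq_maxr //.
rewrite (@peval_wide f (maxn (size p) (size q))) ?size_polyD //.
by rewrite -big_split; apply: eq_bigr => i _; rewrite coefD scalerDl.
Qed.

Lemma pevalC f c v : peval f c%:P v = c *: v.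
Proof.
by rewrite (@peval_wide f 1) ?size_polyC_leq1 // big_ord1 coefC.
Qed.

Lemma pevalMX f p v : peval f (p * 'X) v = peval f p (f v).
Proof.
rewrite (@peval_wide f (size p).+1); last first.
  by have [->|p0] := eqVneq p 0; rewrite ?mul0r ?size_poly0 // size_mulX.
rewrite big_ord_recl coefMX /= scale0r add0r.
by apply: eq_bigr => i _; rewrite coefMX /= -iterSr.
Qed.

Lemma peval_comm f (g : {linear V -> V}) p v : (forall u, f (g u) = g (f u)) ->
  peval f p (g v) = g (peval f p v).
Proof.
move=> fg; rewrite /peval linear_sum; apply: eq_bigr => i _; rewrite linearZ.
by congr (_ *: _); elim: (nat_of_ord i) => //= k ->.
Qed.

Lemma pevalM f p q v : peval f (p * q) v = peval f p (peval f q v).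
Proof.
elim/poly_ind: p v => [|p c IH] v; first by rewrite mul0r !peval0.
rewrite mulrDl !pevalD pevalC -mulrA ['X * q]mulrC mulrA pevalMX IH pevalMX.
congr (_ + _); last first.
  rewrite mul_polyC (@peval_wide f (size q)) ?size_scale_leq // /peval scaler_sumr.
  by apply: eq_bigr => i _; rewrite coefZ scalerA.
by rewrite peval_comm.
Qed.

Lemma peval_polyX_sub f p a v :
  peval f (p * ('X - a%:P)) v = peval f p (f v - a *: v).
Proof.
rewrite pevalM (_ : 'X - a%:P = 1%:P * 'X + (- a)%:P); last by rewrite polyCN mul1r.
by rewrite pevalD pevalMX !pevalC scale1r scaleNr.
Qed.

End PolyEval.

(** * Commutators and nilpotency *)

(** The engine of the proof, after Jacobson, Kleinecke and Shirokov: if a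
    commutator E = [D, X] commutes with D, then bracketing a polynomial relation
    B(D) E^m = 0 with X and multiplying by E^m yields the differentiated
    relation B'(D) E^(2m+1) = 0.  Iterating leaves only the leading
    coefficient. *)
Lemma leading_coef_commutator (K : numFieldType) (V : lmodType K)
    (D X E : {linear V -> V}) n m (B : nat -> {linear V -> V}) :
  (forall v, D (X v) = X (D v) + E v) -> (forall v, D (E v) = E (D v)) ->
  (forall i v, B i (X v) = X (B i v)) -> (forall i v, B i (E v) = E (B i v)) ->
  (forall v, \sum_(i < n.+1) B i (iter i D (iter m E v)) = 0) ->
  exists m', forall v, B n (iter m' E v) = 0.
Proof.
move=> DX DE; elim: n m B => [|n IH] m B BX BE rel.
  by exists m => v; have := rel v; rewrite big_ord1.
have DiE i v : iter i D (E v) = E (iter i D v) by elim: i => //= i ->.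
have DiX i v : iter i.+1 D (X v) = X (iter i.+1 D v) + i.+1%:R *: iter i D (E v).
  elim: i => [|i IHi]; first by rewrite scale1r /= DX.
  rewrite iterS IHi linearD /= DX linearZ /= !DiE DE -[i.+2]addn1 natrD.
  by lmod_arith V; ring.
have EkB i j k u : B i (iter j D (iter k E u)) = iter k E (B i (iter j D u)).
  by elim: k => //= k <-; rewrite DiE BE.
have EmB v : \sum_(i < n.+2) B i (iter i D (iter m E v)) =
             iter m E (\sum_(i < n.+2) B i (iter i D v)).
  by rewrite iter_sum; apply: eq_bigr => i _.
have rel' v : \sum_(i < n.+1) (i.+1%:R *: B i.+1 (iter i D (iter (2 * m).+1 E v))) = 0.
  have BXw w : \sum_(i < n.+2) B i (iter i D (X w)) =
      X (\sum_(i < n.+2) B i (iter i D w))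
      + \sum_(i < n.+1) (i.+1%:R *: B i.+1 (iter i D (E w))).
    rewrite linear_sum [LHS]big_ord_recl [X in _ = X + _]big_ord_recl /= BX -addrA; congr (_ + _).
    rewrite -big_split; apply: eq_bigr => i _.
    by have := congr1 (B i.+1) (DiX i w); rewrite linearD linearZ BX.
  have := EmB (X (iter m E v)); rewrite rel BXw rel linear0 add0r => /esym.
  rewrite iter_sum => H0; rewrite -[RHS]H0; apply: eq_bigr => i _; rewrite iterZ.
  congr (_ *: _); rewrite (_ : (2 * m).+1 = (m + m.+1)%N); last by lia.
  by rewrite iterD EkB.
have [] := IH (2 * m).+1 (fun i => (i.+1%:R \*: B i.+1)%R).
- by move=> i v; rewrite /= BX linearZ.
- by move=> i v; rewrite /= BE linearZ.
- exact: rel'.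
move=> m' Hm'; exists m' => v; have /eqP := Hm' v.
by rewrite scaler_eq0 pnatr_eq0 /= => /eqP.
Qed.


(** * Derivations and lowest modes *)

Section Derivations.

Variables (R : realType) (V : lmodType R[i]) (A : vertexAlgebra V).

Local Notation K := R[i].
Local Notation Y := (va_prod A).
Local Notation T := (va_T A).
Local Notation central := (central A).

Definition derivation (d : V -> V) :=
  forall a n b, d (Y a n b) = Y (d a) n b + Y a n (d b).

Lemma T_derivation : derivation T.
Proof. by move=> a n b; rewrite T_mode addrC. Qed.

(** The top term of the Leibniz rule. *)
Lemma derivation_iter_top (d : {linear V -> V}) a b v w n : derivation d ->
  iter a.+1 d v = 0 -> iter b.+1 d w = 0 ->
  iter (a + b) d (Y v n w) = Y (iter a d v) n (iter b d w) *+ 'C(a + b, a).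
Proof.
move=> dD; move Ds: (a + b)%N => s; elim: s a b v w Ds => [|s IH] a b v w Ds.
  by have [-> ->] : a = 0%N /\ b = 0%N by lia.
move=> dv dw; rewrite iterSr dD iterD_lin; case: a b Ds dv dw => [|a] [|b] Ds dv dw //.
- have ds : b = s by lia.
  rewrite [d v]dv mode0l iter0 add0r (IH 0%N b) //; first by rewrite !bin0 -iterSr.
  by rewrite -iterSr.
- have ds : a = s by lia.
  rewrite [d w]dw linear0 iter0 addr0 (IH a 0%N) //; last by rewrite -iterSr.
    by rewrite -iterSr ds binn binn.
  by lia.
rewrite (IH a b.+1) //; last by rewrite -iterSr.
  rewrite (IH a.+1 b) //; last 1 first.
  - by rewrite -iterSr.
  - by rewrite -!iterSr -mulrnDr binS addnC.
  - by lia.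
by lia.
Qed.

Definition low (k : nat) (v : V) := forall i : nat, (i < k)%N -> forall w, Y v i w = 0.

Lemma low0 v : low 0 v. Proof. by []. Qed.

Lemma lowB k u v : low k u -> low k v -> low k (u - v).
Proof. by move=> ku kv i lti w; rewrite modeBl ku // kv // subrr. Qed.

Lemma lowD k u v : low k u -> low k v -> low k (u + v).
Proof. by move=> ku kv i lti w; rewrite modeDl ku // kv // addr0. Qed.

Lemma lowZ k c v : low k v -> low k (c *: v).
Proof. by move=> kv i lti w; rewrite modeZl kv // scaler0. Qed.

Lemma low_sum k (I : Type) (r : seq I) (F : I -> V) :
  (forall i, low k (F i)) -> low k (\sum_(i <- r) F i).
Proof.
move=> kF; elim/big_rec: _ => [|i y _ ky]; last exact: lowD.
by move=> i _ w; rewrite mode0l.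
Qed.

Lemma lowW k k' v : (k' <= k)%N -> low k v -> low k' v.
Proof. by move=> lek kv i lti; apply: kv; exact: leq_trans lek. Qed.

Lemma low_central v : (forall k, low k v) -> central v.
Proof. by move=> H n w; exact: (H n.+1). Qed.

Lemma central_low k v : central v -> low k v.
Proof. by move=> cv i _ w; exact: cv. Qed.

Lemma lowS k v : low k v -> (forall w, Y v k w = 0) -> low k.+1 v.
Proof. by move=> kv vk i; rewrite ltnS leq_eqVlt => /orP[/eqP->|/kv]. Qed.

Lemma low_T k v : low k v -> low k.+1 (T v).
Proof.
move=> kv [|i] lti w; first exact: T_mode_nat0.
by rewrite T_mode_nat_succ kv // scaler0 oppr0.
Qed.

Lemma low_iterT k i v : low k v -> low (k + i) (iter i T v).
Proof. by move=> kv; elim: i => [|i IH]; rewrite ?addn0 // addnS; apply: low_T. Qed.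

Lemma derivation_low (d : {linear V -> V}) k v : derivation d -> low k v -> low k (d v).
Proof.
move=> dD kv i lti w; have := dD v i w; rewrite !kv // linear0 addr0.
by move=> <-.
Qed.

Lemma derivation_central (d : {linear V -> V}) v : derivation d -> central v -> central (d v).
Proof. by move=> dD cv; apply: low_central => k; apply: derivation_low => //; apply: central_low. Qed.

(** In the commutator formula only the term with j = k survives. *)
Lemma low_derivation k l : low k l -> derivation (Y l k).
Proof.
move=> kl a n b; rewrite mode_commutator big_ord_recr /= big1 ?add0r.
  by rewrite binn scale1r subrr addr0 addrC.
by move=> i _; rewrite kl // mode0l scaler0.
Qed.

Lemma low_commT k l v : low k l -> Y l k (T v) = T (Y l k v).
Proof.
move=> kl; rewrite T_mode; case: k kl => [|k] kl; first by rewrite T_mode_nat0 addr0.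
by rewrite T_mode_nat_succ (kl k) // scaler0 oppr0 addr0.
Qed.

Section SimpleDerivations.

Hypothesis simpleA : va_simple A.

(** If n + 1 is the nilpotency order of d, then d^(2n) vanishes, but on a_(j) b
    it equals a multiple of (d^n a)_(j) (d^n b). *)
Lemma nilpotent_derivation_eq0 (d : {linear V -> V}) m :
  derivation d -> (forall v, iter m d v = 0) -> forall v, d v = 0.
Proof.
move=> dD dm; pose P m := `[< forall v, iter m d v = 0 >].
have exP : exists m, P m by exists m; apply/asboolP.
case: (ex_minnP exP) => -[|[|n]] /asboolP dn minn.
- by move=> v; have := dn v => /= ->; rewrite linear0.
- by move=> v; exact: dn.
exfalso; suff /minn : P n.+1 by rewrite ltnn.
apply/asboolP; suff H v w j : Y (iter n.+1 d v) j (iter n.+1 d w) = 0.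
  by move=> v; have [] := simple_mode_eq0 simpleA (fun j => H v v j).
have := derivation_iter_top j dD (dn v) (dn w).
rewrite (_ : (n.+1 + n.+1)%N = (n + n.+2)%N); last by lia.
rewrite iterD dn iter0 => /esym/eqP; rewrite -scaler_nat scaler_eq0 pnatr_eq0.
by rewrite -leqn0 leqNgt bin_gt0; case/orP => [|/eqP //]; lia.
Qed.

(** Suppose d^a e^b = 0.  If neither derivation is nilpotent, there are v with
    d v = 0 and e^b v nonzero, and w with e w = 0 and d^a w nonzero; then
    d^a e^b (v_(j) w) = (e^b v)_(j) (d^a w) is nonzero for some j. *)
Lemma commuting_derivations_eq0 (d e : {linear V -> V}) s t :
  derivation d -> derivation e -> (forall v, d (e v) = e (d v)) ->
  (forall v, iter s d (iter t e v) = 0) ->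
  (forall v, d v = 0) \/ (forall v, e v = 0).
Proof.
move=> dD eD de dest.
have itC (f g : V -> V) i j v : (forall u, f (g u) = g (f u)) ->
    iter i f (iter j g v) = iter j g (iter i f v).
  move=> fg; elim: i => //= i ->; elim: j => //= j IH; by rewrite fg IH.
pose Pd s := `[< exists t, forall v, iter s d (iter t e v) = 0 >].
pose Pe t := `[< exists s, forall v, iter s d (iter t e v) = 0 >].
have exd : exists s, Pd s by exists s; apply/asboolP; exists t.
have exe : exists t, Pe t by exists t; apply/asboolP; exists s.
case: (ex_minnP exd) => -[|s0] /asboolP [t1 H1] mind.
  by right; apply: (nilpotent_derivation_eq0 eD H1).
case: (ex_minnP exe) => -[|t0] /asboolP [s1 H2] mine.
  by left; apply: (nilpotent_derivation_eq0 dD H2).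
exfalso; pose a := (s1 + s0.+1)%N.
have [v0 Hv] : exists v, iter s0 d (iter (t1 + t1) e v) <> 0.
  apply/not_existsP => H; suff /mind : Pd s0 by rewrite ltnn.
  by apply/asboolP; exists (t1 + t1)%N => v; apply: contrapT => /(H v).
have [w0 Hw] : exists w, iter (a + a) d (iter t0 e w) <> 0.
  apply/not_existsP => H; suff /mine : Pe t0 by rewrite ltnn.
  by apply/asboolP; exists (a + a)%N => v; apply: contrapT => /(H v).
pose v := iter s0 d (iter t1 e v0); pose w := iter a d (iter t0 e w0).
have dv : d v = 0 by exact: H1.
have ew : e w = 0.
  rewrite /w -[e (iter a d _)](itC d e a 1%N) // /a addnC iterD -iterS.
  by rewrite H2 iter0.
have E j : iter t1 e (iter a d (Y v j w)) = Y (iter t1 e v) j (iter a d w).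
  have -> : iter a d (Y v j w) = Y v j (iter a d w).
    by elim: (a) => //= k ->; rewrite dD dv mode0l add0r.
  elim: (t1) => //= k ->; rewrite eD.
  rewrite -[e (iter a d w)](itC d e a 1%N) //= ew iter0 linear0 addr0 //.
have /(simple_mode_eq0 simpleA) [] j : Y (iter t1 e v) j (iter a d w) = 0.
- by rewrite -E -itC // /a iterD H1 iter0.
- by rewrite /v -itC // -iterD.
- by rewrite /w -iterD.
Qed.

End SimpleDerivations.

(** * Linear dependence over the polynomials in T *)

Lemma polyTE p v : polyT A p v = peval T p v.
Proof. by []. Qed.

(** The coordinates of the vectors form a matrix over C[T] with n * m columns and
    one more row; padded with a zero column it is singular. *)
Lemma finite_dependent n (g : 'I_n -> V) m (x : 'I_(n * m).+1 -> 'I_m -> V) :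
  (forall v, exists p : 'I_n -> {poly K}, v = \sum_(i < n) polyT A (p i) (g i)) ->
  exists2 p : 'I_(n * m).+1 -> {poly K}, exists i, p i != 0 &
    forall j, \sum_i polyT A (p i) (x i j) = 0.
Proof.
move=> gen.
have [P xE] : exists P : 'I_(n * m).+1 -> 'I_m -> 'I_n -> {poly K},
    forall i j, x i j = \sum_k polyT A (P i j k) (g k).
  have [P HP] := choice (fun ij : 'I_(n * m).+1 * 'I_m => gen (x ij.1 ij.2)).
  by exists (fun i j => P (i, j)) => i j; rewrite -(HP (i, j)).
have cardE : #|{: 'I_n * 'I_m}| = (n * m)%N by rewrite card_prod !card_ord.
pose M : 'M[{poly K}]_((n * m).+1) := \matrix_(i, c)
  if unlift ord_max c is Some c' then
    let kj := enum_val (cast_ord (esym cardE) c') in P i kj.2 kj.1 else 0.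
have /det0P [u u0 uM] : \det M == 0.
  rewrite (expand_det_col M ord_max) big1 // => i _.
  by rewrite mxE unlift_none mul0r.
exists (fun i => u 0 i) => [|j].
  by apply/rV0Pn.
under eq_bigr => i _ do rewrite xE polyTE (peval_lin_sum T).
rewrite exchange_big big1 // => k _.
transitivity (polyT A (\sum_i u 0 i * P i j k) (g k)).
  elim/big_rec2: _ => [|i y q _ ->]; first by rewrite polyTE peval0.
  by rewrite !polyTE pevalD pevalM.
rewrite (_ : \sum_i _ = 0) ?polyTE ?peval0 //.
pose c := lift ord_max (cast_ord cardE (enum_rank (k, j))).
have := congr1 (fun N : 'rV[{poly K}]_((n * m).+1) => N 0 c) uM; rewrite mxE [RHS]mxE => H0; rewrite -[RHS]H0.
by apply: eq_bigr => i _; rewrite mxE liftK cast_ordK enum_rankK.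
Qed.

(** The lowest coefficients of a relation over C[T] give a relation over C
    between lowest modes. *)
Lemma low_dependent : va_finite A -> exists n : nat, forall k (x : 'I_n.+1 -> V),
  (forall i, low k (x i)) ->
  exists2 c : 'I_n.+1 -> K, exists i, c i != 0 & low k.+1 (\sum_i c i *: x i).
Proof.
move=> [n [g gen]]; exists (n * 1)%N => k x kx.
have [p [s ps0] /(_ 0) rel] := finite_dependent (m := 1) (fun i _ => x i) gen.
have exi : exists i : nat, [exists s, (p s)`_i != 0].
  by exists (size (p s)).-1; apply/existsP; exists s; rewrite lead_coef_eq0.
case: (ex_minnP exi) => i0 /existsP [s0 Hs0] mini.
(* At the mode k + i0 higher powers of T contribute nothing, since the vectors
   have no modes below k. *)
exists (fun s => (p s)`_i0); first by exists s0.
apply: lowS => [|w]; first by apply: low_sum => i; apply: lowZ.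
have := congr1 (fun u => Y u (k + i0)%N w) rel; rewrite mode_suml mode0l.
have E s' : Y (polyT A (p s') (x s')) (k + i0)%N w =
    (-1) ^+ i0 *: (((k + i0) ^_ i0)%:R *: Y ((p s')`_i0 *: x s') k w).
  pose N := (maxn (size (p s')) i0.+1).
  rewrite polyTE (@peval_wide _ _ T N) ?leq_maxl // mode_suml.
  have lti0 : (i0 < N)%N by rewrite leq_max leqnn orbT.
  rewrite (bigD1 (Ordinal lti0)) //= big1 ?addr0.
    by rewrite modeZl mode_iterT leq_addl addnK modeZl !scalerA; congr (_ *: _); ring.
  move=> i /eqP nei; have [lti|lti|eqi] := ltngtP i i0.
  - have /eqP -> : (p s')`_i == 0.
      by apply: contraTT lti => nz; rewrite -leqNgt; apply: mini; apply/existsP; exists s'.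
    by rewrite scale0r mode0l.
  - rewrite modeZl mode_iterT; case: ifP => lei; last by rewrite scaler0.
    by rewrite kx ?scaler0 //; lia.
  - by case: nei; apply: val_inj.
under eq_bigr => s' _ do rewrite E.
rewrite -!scaler_sumr -mode_suml => /eqP; rewrite !scaler_eq0 signr_eq0 pnatr_eq0.
by rewrite -leqn0 leqNgt ffact_gt0 leq_addl => /eqP.
Qed.

Lemma iter_comm (f g : V -> V) i v : (forall u, f (g u) = g (f u)) ->
  iter i f (g v) = g (iter i f v).
Proof. by move=> fg; elim: i => //= i ->. Qed.

(** The relation is imposed on the images of all generators at once, and then
    extends to V by T-linearity of D. *)
Lemma operator_relation (D : {linear V -> V}) : va_finite A ->
  (forall v, D (T v) = T (D v)) ->
  exists2 P : {poly {poly K}}, P != 0 &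
    forall v, \sum_(i < size P) peval T P`_i (iter i D v) = 0.
Proof.
move=> [n [g gen]] DT.
have [p [s ps0] rel] := finite_dependent (fun i j => iter i D (g j)) gen.
pose P := \poly_(i < (n * n).+1) p (inord i).
have PE (i : 'I_(n * n).+1) : P`_i = p i by rewrite coef_poly ltn_ord inord_val.
exists P => [|v].
  by apply: contraNneq ps0 => P0; rewrite -PE P0 coef0.
have -> : \sum_(i < size P) peval T P`_i (iter i D v) =
    \sum_(i < (n * n).+1) peval T (p i) (iter i D v).
  rewrite (big_ord_widen _ (fun i => peval T P`_i (iter i D v)) (size_poly _ _)) big_mkcond.
  apply: eq_bigr => i _; rewrite -PE; case: ltnP => // /(nth_default 0) ->.
  by rewrite peval0.
have [q ->] := gen v.
transitivity (\sum_j peval T (q j) (\sum_i peval T (p i) (iter i D (g j)))).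
  under eq_bigr => i _ do rewrite iter_sum peval_lin_sum.
  rewrite exchange_big; apply: eq_bigr => j _; rewrite peval_lin_sum.
  apply: eq_bigr => i _; rewrite polyTE iter_comm => [|u]; last by rewrite peval_comm.
  by rewrite -!pevalM mulrC.
rewrite big1 // => j _.
exact: etrans (congr1 (peval T (q j)) (rel j)) (peval_lin0 _ _).
Qed.

(** This form of a relation can be bracketed with an operator that commutes with
    D but not with T. *)
Lemma operator_relation_swap (D : {linear V -> V}) (P : {poly {poly K}}) v :
  (forall v, D (T v) = T (D v)) ->
  \sum_(i < size P) peval T P`_i (iter i D v) =
  \sum_(j < size (swapXY P)) peval D (swapXY P)`_j (iter j T v).
Proof.
move=> DT; rewrite -sizeYE.
transitivity (\sum_(i < size P) \sum_(j < sizeY P) P`_i`_j *: iter j T (iter i D v)).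
  by apply: eq_bigr => i _; rewrite -peval_wide // max_size_coefXY.
rewrite exchange_big; apply: eq_bigr => j _ /=.
rewrite (@peval_wide _ _ D (size P)).
  apply: eq_bigr => i _; rewrite coef_swapXY; congr (_ *: _).
  by rewrite (@iter_comm D (iter j T)) // => u; elim: (nat_of_ord j) => //= k <-; rewrite DT.
by apply: leq_trans (max_size_coefXY _ _) _; rewrite sizeYE swapXYK.
Qed.

End Derivations.

(** * Lowest modes are multiples of T *)

Section Lowest.

Variables (R : realType) (V : lmodType R[i]) (A : vertexAlgebra V).

Local Notation K := R[i].
Local Notation Y := (va_prod A).
Local Notation T := (va_T A).
Local Notation central := (central A).
Local Notation low := (low A).

(** A polynomial in f splits into factors f - a.  Those with a nonzero can be
    cancelled inside G, and the remaining ones collect to a power of f. *)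
Lemma root_chain (f : {linear V -> V}) (W G : V -> Prop) (p : {poly K}) :
  (forall a w, W w -> W (f w - a *: w)) ->
  (forall w, G w -> G (f w)) -> (forall c w, G w -> G (c *: w)) ->
  (forall a w, a != 0 -> W w -> G (f w - a *: w) -> G w) -> p != 0 ->
  exists s, forall w, W w -> G (peval f p w) -> G (iter s f w).
Proof.
move=> Wf Gf GZ Groot p0; have [rs pE] := closed_field_poly_normal p.
exists (size rs) => w Ww; rewrite {}pE -mul_polyC pevalM pevalC => /(GZ (lead_coef p)^-1).
rewrite scalerA mulVf ?lead_coef_eq0 // scale1r.
elim: rs w Ww => [|r rs IH] w Ww.
  by rewrite big_nil -[1]/(1%:P) pevalC scale1r.
rewrite big_cons mulrC peval_polyX_sub => /(IH _ (Wf r w Ww)).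
have -> : iter (size rs) f (f w - r *: w) = f (iter (size rs) f w) - r *: iter (size rs) f w.
  by rewrite iterD_lin -scaleNr iterZ -iterSr scaleNr.
have Witer k : W (iter k f w).
  by elim: k => //= k /(Wf 0); rewrite scale0r subr0.
have [->|r0] := eqVneq r 0; first by rewrite scale0r subr0.
by move=> /Groot H; rewrite /=; apply: Gf; apply: H.
Qed.

Hypotheses (simpleA : va_simple A) (finA : va_finite A).

(** If a lowest mode E is a commutator of T-linear operators and commutes with
    D, then E^m is torsion valued, hence E is nilpotent because torsion is
    central. *)
Lemma lowest_commutator_eq0 (D X : {linear V -> V}) k l : low k l ->
  (forall v, D (T v) = T (D v)) -> (forall v, X (T v) = T (X v)) ->
  (forall v, D (X v) = X (D v) + Y l k v) ->
  (forall v, D (Y l k v) = Y l k (D v)) -> forall v, Y l k v = 0.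
Proof.
move=> kl DT XT DX DE; have [P P0 rel] := operator_relation finA DT.
have sP : size P = (size P).-1.+1 by rewrite prednK // size_poly_gt0.
have [|||m' Hm'] := @leading_coef_commutator K V D X (Y l k) (size P).-1 0
  (fun i => peval T P`_i) DX DE.
- by move=> i v; rewrite /= peval_comm // => u; rewrite XT.
- by move=> i v; rewrite /= peval_comm // => u; rewrite low_commT.
- by move=> v; rewrite -sP; exact: rel.
apply: (nilpotent_derivation_eq0 simpleA (m := m'.+1)) => [|v].
  exact: low_derivation.
rewrite iterS mode_central0 //; apply: torsion_central (Hm' v).
by rewrite lead_coef_eq0.
Qed.

(** Modulo vectors starting at k' + 1, the operator d = l_(k) satisfies a
    polynomial equation.  An eigenvector u with eigenvalue a nonzero has
    [d, u_(k')] = a u_(k'), and a vector with d u outside and d^2 u inside yields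
    a commutator that commutes with d; both are excluded by
    [lowest_commutator_eq0]. *)
Lemma low_abelian k l k' l' : low k l -> low k' l' -> low k'.+1 (Y l k l').
Proof.
move=> kl; set d := Y l k; have dD : derivation A d := low_derivation kl.
have dT v : d (T v) = T (d v) := low_commT v kl.
have brk u v : d (Y u k' v) = Y u k' (d v) + Y (d u) k' v by rewrite dD addrC.
have root a u : a != 0 -> low k' u -> low k'.+1 (d u - a *: u) -> low k'.+1 u.
  move=> a0 k'u H; apply: lowS => // w.
  suff : Y ((- a) *: u) k' w = 0.
    by rewrite modeZl => /eqP; rewrite scaler_eq0 oppr_eq0 (negPf a0) => /eqP.
  have du v : Y (d u) k' v = a *: Y u k' v.
    by apply/eqP; rewrite -subr_eq0 -modeZl -modeBl H.
  (* Here u_(k') plays the role of D and d that of X. *)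
  apply: (@lowest_commutator_eq0 (Y u k') d) => // [|v|v|v].
  - exact: lowZ.
  - exact: low_commT.
  - by rewrite brk du modeZl scaleNr addrK.
  - by rewrite !modeZl linearZ.
have nilp u : low k' u -> low k'.+1 (d (d u)) -> low k'.+1 (d u).
  move=> k'u H; apply: lowS => [|w]; first exact: derivation_low.
  apply: (@lowest_commutator_eq0 d (Y u k')) => // [|v|v].
  - exact: derivation_low.
  - exact: low_commT.
  - by rewrite dD H // add0r.
move=> k'l'; have [n dep] := low_dependent finA.
have k'd i : low k' (iter i d l') by elim: i => //= i; apply: derivation_low.
have [c [i ci] H] := dep k' (fun i => iter i d l') (fun i => k'd i).
pose p := \poly_(i < n.+1) c (inord i).
have pE (j : 'I_n.+1) : p`_j = c j by rewrite coef_poly ltn_ord inord_val.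
have p0 : p != 0 by apply: contraNneq ci => p0; rewrite -pE p0 coef0.
have [|||s Hs] := @root_chain d (low k') (low k'.+1) p _ _ _ root p0.
- by move=> a w k'w; apply: lowB; [apply: derivation_low | apply: lowZ].
- by move=> w; apply: derivation_low.
- by move=> b w; apply: lowZ.
have {Hs} : low k'.+1 (iter s d l').
  apply: Hs => //; rewrite (@peval_wide _ _ d n.+1) ?size_poly //.
  by under eq_bigr => j _ do rewrite pE.
elim: s => [|s IH]; first exact: derivation_low.
case: s IH => [|s] IH Hs; first exact: Hs.
by apply: IH; apply: nilp => //; exact: k'd.
Qed.

(** The operator d = l_(k) - c T commutes with the lowest mode of v, whereas on
    an eigenvector v the commutator is b times that mode. *)
Lemma low_eigen_central k l c b v : low k l -> b != 0 ->
  central (Y l k v - c *: T v - b *: v) -> central v.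
Proof.
move=> kl b0 H; apply: low_central; elim=> // m mv; apply: lowS => // w.
have := H m w; rewrite !modeBl !modeZl (low_abelian kl mv) // (low_T mv) //.
by rewrite scaler0 subrr sub0r => /eqP; rewrite oppr_eq0 scaler_eq0 (negPf b0) => /eqP.
Qed.

(* The homogenization of degree n of P, evaluated at (d, T). *)
Let hom (d : V -> V) n (P : {poly K}) v := \sum_(i < n.+1) P`_i *: iter (n - i) T (iter i d v).

Let homMX (d : {linear V -> V}) n (P : {poly K}) r v : (forall v, d (T v) = T (d v)) ->
  (size P <= n.+1)%N ->
  hom d n.+1 (P * ('X - r%:P)) v = hom d n P (d v - r *: T v).
Proof.
move=> dT sP.
have -> : hom d n.+1 (P * ('X - r%:P)) v = hom d n.+1 (P * 'X) v - r *: hom d n.+1 P v.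
  rewrite /hom scaler_sumr -sumrB; apply: eq_bigr => i _.
  by rewrite mulrBr coefB coefMC scalerBl scalerA [r * _]mulrC.
have -> : hom d n P (d v - r *: T v) = hom d n P (d v) - r *: hom d n P (T v).
  rewrite /hom scaler_sumr -sumrB; apply: eq_bigr => i _.
  by rewrite -scaleNr !(iterD_lin, iterZ); lmod_arith V; ring.
congr (_ - _ *: _); rewrite /hom.
  rewrite big_ord_recl coefMX scale0r add0r; apply: eq_bigr => i _.
  by rewrite coefMX /= subSS -iterSr.
rewrite big_ord_recr /= [P`_n.+1]nth_default // scale0r addr0.
apply: eq_bigr => i _; rewrite (iter_comm (f := d) (g := T)) // subSn ?leq_ord //.
by rewrite iterSr.
Qed.

(** Put d = l_(k).  On lowest modes d and T satisfy a homogeneous relation, which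
    factors into terms d - c T.  Hence for some u and c the vector (d - c T) u
    starts one order later than expected.  Then d - c T commutes with the mode X
    of u following its lowest mode E, whereas [T, X] is a multiple of E.
    Removing T from a polynomial relation between T and d - c T leaves
    (d - c T)^s E^m = 0, and E is not zero. *)
Lemma lowest_mode_scalar k l : low k l -> exists c, forall v, Y l k v = c *: T v.
Proof.
move=> kl; set d := Y l k; have dD : derivation A d := low_derivation kl.
have dT v : d (T v) = T (d v) := low_commT v kl.
have [d0|d0] := pselect (forall v, d v = 0).
  by exists 0 => v; rewrite scale0r.
(* If no such u existed, each factor of the homogeneous relation on l could be
   cancelled, and l would start beyond k. *)
have [k' [u [c [k'u H nk'u]]]] : exists k' u c,
    [/\ low k' u, low k'.+2 (d u - c *: T u) & ~ low k'.+1 u].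
  apply: contrapT => Hno.
  have no k' u c : low k' u -> low k'.+2 (d u - c *: T u) -> low k'.+1 u.
    by move=> k'u H; apply: contrapT => nH; apply: Hno; exists k', u, c.
  have noT k' u : low k' u -> low k'.+2 (T u) -> low k'.+1 u.
    move=> k'u H; apply: lowS => // w; have := H k'.+1 (ltnSn _) w.
    by rewrite T_mode_nat_succ => /eqP; rewrite oppr_eq0 scaler_eq0 pnatr_eq0 => /eqP.
  have homlow n k' (P : {poly K}) u : low k' u -> P != 0 -> (size P <= n.+1)%N ->
      low (k' + n).+1 (hom d n P u) -> low k'.+1 u.
    elim: n k' P u => [|n IH] k' P u k'u P0 sP.
      have PC := size1_polyC sP; have c0 : P`_0 != 0.
        by apply: contraNneq P0 => c0; rewrite PC c0.
      rewrite addn0 /hom big_ord1 /= => /(lowZ (P`_0)^-1).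
      by rewrite scalerA mulVf // scale1r.
    have [sP'|sP'] := leqP (size P) n.+1.
      rewrite /hom big_ord_recr /= [P`_n.+1]nth_default // scale0r addr0 => Hl.
      apply: noT => //; apply: IH (P0) sP' _; first exact: low_T.
      rewrite addSnnS; congr (low _ _): Hl; apply: eq_bigr => i _.
      by rewrite (iter_comm (f := d) (g := T)) // subSn ?leq_ord // iterSr.
    have /closed_rootP [r /factor_theorem [Q PE]] : size P != 1%N by rewrite neq_ltn (leq_trans _ sP') ?orbT.
    have Q0 : Q != 0 by apply: contraNneq P0 => Q0; rewrite PE Q0 mul0r.
    have sQ : (size Q <= n.+1)%N.
      by move: sP; rewrite PE size_Mmonic ?monicXsubC // size_XsubC addn2.
    rewrite PE homMX // => Hl; apply: (no _ _ r) => //.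
    apply: IH Q0 sQ _.
      apply: lowB; first exact: low_abelian.
      by apply: lowZ; apply: low_T.
    by rewrite addSnnS.
  have [n dep] := low_dependent finA.
  have ld i : low (k + i) (iter i d l).
    by elim: i => [|i IH]; rewrite ?addn0 // addnS; apply: low_abelian.
  have [i|c [i ci] Hc] := dep (k + n)%N (fun i => iter (n - i) T (iter i d l)).
    rewrite -[n in low (k + n)](subnKC (leq_ord i)) addnA; exact: low_iterT.
  apply: d0 => v; apply: (homlow n k (\poly_(i < n.+1) c (inord i)) l) => //.
  - apply: contraNneq ci => /(congr1 (fun p : {poly K} => p`_i)).
    by rewrite coef_poly ltn_ord inord_val coef0 => ->.
  - rewrite /hom; congr (low _ _): Hc; apply: eq_bigr => j _.
    by rewrite coef_poly ltn_ord inord_val.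
pose D : {linear V -> V} := (d \- c \*: T)%R.
have DD : derivation A D.
  by move=> a n b; rewrite /= dD T_derivation modeBl modeZl [Y a n (_ - _)]linearB [Y a n (c *: _)]linearZ /=; lmod_arith V; ring.
have DT v : D (T v) = T (D v) by rewrite /= dT [RHS]linearB [T (c *: _)]linearZ.
(* The scalar makes the mode e_(k') equal to [T, u_(k'+1)]. *)
pose e := (- k'.+1%:R : K) *: u; have k'e : low k' e by exact: lowZ.
have [P P0 rel] := operator_relation finA DT.
pose Q := swapXY P; have Q0 : Q != 0 by rewrite swapXY_eq0.
have sQ : size Q = (size Q).-1.+1 by rewrite prednK // size_poly_gt0.
have [|||||m Hm] := @leading_coef_commutator K V T (Y u k'.+1) (Y e k') (size Q).-1 0
  (fun j => peval D Q`_j).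
- by move=> v; rewrite T_mode T_mode_nat_succ /e modeZl scaleNr.
- by move=> v; rewrite low_commT.
- move=> j v; rewrite /= (peval_comm (f := D) (g := Y u k'.+1)) // => w.
  by rewrite DD H // add0r.
- move=> j v; rewrite /= (peval_comm (f := D) (g := Y e k')) // => w.
  by rewrite DD /e linearZ /= modeZl H // scaler0 add0r.
- by move=> v; rewrite -sQ -operator_relation_swap.
have q0 : Q`_(size Q).-1 != 0 by rewrite lead_coef_eq0.
have [||||s Hs] := @root_chain D (fun _ => True) central Q`_(size Q).-1 _ _ _ _ q0.
- by [].
- by move=> w; apply: derivation_central.
- by move=> b w; apply: centralZ.
- by move=> b w b0 _; apply: low_eigen_central kl b0.
have Dest v : iter s D (iter m.+1 (Y e k') v) = 0.
  rewrite iterS iter_comm => [|w].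
    by rewrite mode_central0 //; apply: Hs => //; rewrite Hm; exact: central0.
  by rewrite DD /e linearZ /= modeZl H // scaler0 add0r.
have [||v|D0|E0] := commuting_derivations_eq0 simpleA _ _ _ Dest.
- exact: DD.
- exact: low_derivation.
- by rewrite DD /e linearZ /= modeZl H // scaler0 add0r.
- by exists c => v; apply/eqP; rewrite -subr_eq0 -[X in X == 0]/(D v) D0.
case: nk'u; apply: lowS => // w; have := E0 w.
by rewrite /e modeZl => /eqP; rewrite scaler_eq0 oppr_eq0 pnatr_eq0 => /eqP.
Qed.

End Lowest.

(** * A conformal vector *)

Section Conformal.

Variables (R : realType) (V : lmodType R[i]) (A : vertexAlgebra V).

Local Notation K := R[i].
Local Notation Y := (va_prod A).
Local Notation T := (va_T A).
Local Notation central := (central A).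
Local Notation low := (low A).

Lemma mode_commutator_nat a b (m n : nat) c :
  Y a m (Y b n c) = Y b n (Y a m c)
    + \sum_(j < m.+1) 'C(m, j)%:R *: Y (Y a j b) (n + (m - j))%N c.
Proof.
rewrite mode_commutator; congr (_ + _); apply: eq_bigr => j _.
by rewrite subzn ?leq_ord // -PoszD.
Qed.

Lemma mode_Tr_nat a (n : nat) b : Y a n.+1 (T b) = T (Y a n.+1 b) + n.+1%:R *: Y a n b.
Proof. by rewrite mode_Tr -pmulrn (_ : n.+1%:Z - 1 = n) //; lia. Qed.

Lemma mode_Tr0 a b : Y a 0 (T b) = T (Y a 0 b).
Proof. by rewrite mode_Tr scale0r addr0. Qed.

(** If all modes below k > 0 vanish on V, then [l_(k+2), l_(k-1)] = 0, but the
    commutator formula evaluates it as a nonzero multiple of T. *)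
Lemma lowest_order_eq0 k l t : (forall v, low k v) -> (forall w, Y l k w = T w) ->
  T t != 0 -> k = 0%N.
Proof.
case: k => // k lowk lT Tt; exfalso.
have l0 (i : nat) u w : (i < k.+1)%N -> Y u i w = 0 by move=> lti; exact: lowk.
have sum0 u (m : nat) n w :
    \sum_(j < k.+1) 'C(m, j)%:R *: Y (Y l j u) (n + (m - j))%N w = 0.
  by rewrite big1 // => j _; rewrite [Y l j u]l0 // mode0l scaler0.
have E1 : Y (Y l k.+2 l) k.+1 t = (k.+2%:R + k.+2%:R * k.+2%:R) *: T t.
  have := mode_commutator_nat l l k.+2 k.+1 t.
  rewrite 2!big_ord_recr /= sum0 add0r !lT mode_Tr_nat lT.
  rewrite (_ : (k.+1 + (k.+2 - k.+1))%N = k.+2); last by lia.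
  rewrite (_ : (k.+1 + (k.+2 - k.+2))%N = k.+1); last by lia.
  rewrite T_mode_nat_succ lT binSn binn scale1r => /addrI H.
  by rewrite -[LHS](addKr (k.+2%:R *: - (k.+2%:R *: T t))) -H; lmod_arith V; ring.
have := mode_commutator_nat l l k.+3 k t.
rewrite 3!big_ord_recr /= sum0 add0r [Y l k t]l0 // linear0 [Y l k _]l0 // add0r.
rewrite (_ : (k + (k.+3 - k.+1))%N = k.+2); last by lia.
rewrite (_ : (k + (k.+3 - k.+2))%N = k.+1); last by lia.
rewrite (_ : (k + (k.+3 - k.+3))%N = k); last by lia.
rewrite [Y _ k t]l0 // scaler0 addr0 lT T_mode_nat_succ lT E1 binSn.
have C2 : 2%:R * 'C(k.+3, k.+1)%:R = k.+3%:R * k.+2%:R :> K.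
  by rewrite -!natrM; congr (_%:R); have := mul_bin_left k.+3 k.+1; rewrite binSn; lia.
move=> /(congr1 (fun u => 2%:R *: u)); rewrite scaler0 => /esym/eqP.
have -> : 2%:R *: ('C(k.+3, k.+1)%:R *: - (k.+2%:R *: T t)
    + k.+3%:R *: ((k.+2%:R + k.+2%:R * k.+2%:R) *: T t))
  = (k.+3 * k.+2 * k.+4)%:R *: T t.
  transitivity ((- (2%:R * 'C(k.+3, k.+1)%:R) * k.+2%:R
      + 2%:R * k.+3%:R * (k.+2%:R + k.+2%:R * k.+2%:R)) *: T t).
    by lmod_arith V; ring.
  by rewrite C2; lmod_arith V; ring.
by rewrite scaler_eq0 pnatr_eq0 (negPf Tt).
Qed.

Hypotheses (simpleA : va_simple A) (finA : va_finite A).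

Lemma exists_translation_vector : ~ va_commutative A ->
  exists l t, (forall w, Y l 0 w = T w) /\ T t != 0.
Proof.
move=> nC; have exk : exists k, `[< exists v, ~ low k.+1 v >].
  apply: contrapT => H; apply: nC => a b [n _|//].
  apply: contrapT => nz; apply: H; exists n; apply/asboolP; exists a => la.
  exact/nz/la.
case: (ex_minnP exk) => k /asboolP [v nv] mink.
have lowk u : low k u.
  case: k mink {nv} => // k mink; apply: contrapT => nu.
  by have := mink k (asboolT (ex_intro _ u nu)); rewrite ltnn.
have [c cE] := lowest_mode_scalar simpleA finA (lowk v).
have [w nw] : exists w, Y v k w <> 0.
  by apply/not_existsP => H; apply: nv; apply: lowS => // w; apply: contrapT => /(H w).
have c0 : c != 0 by apply/eqP => c0; apply: nw; rewrite cE c0 scale0r.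
have Tw : T w != 0 by apply/eqP => Tw; apply: nw; rewrite cE Tw scaler0.
have lE u : Y (c^-1 *: v) k u = T u by rewrite modeZl cE scalerA mulVf // scale1r.
have k0 := lowest_order_eq0 lowk lE Tw.
by exists (c^-1 *: v), w; split=> // u; rewrite -lE k0.
Qed.

Lemma noncentral_lowest v : ~ central v ->
  exists i c, [/\ c != 0, low i v & forall w, Y v i w = c *: T w].
Proof.
move=> nc; have exi : exists i, `[< ~ low i.+1 v >].
  apply: contrapT => H; apply: nc => n w; apply: contrapT => nz.
  by apply: H; exists n; apply/asboolP => lv; apply: nz; apply: lv.
case: (ex_minnP exi) => i /asboolP nv mini.
have lv : low i v.
  case: i nv mini => // i nv mini; apply: contrapT => nu.
  by have := mini i (asboolT nu); rewrite ltnn.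
have [c cE] := lowest_mode_scalar simpleA finA lv.
exists i, c; split=> //; apply/eqP => c0; apply: nv; apply: lowS => // w.
by rewrite cE c0 scale0r.
Qed.

Section Coordinate.

Variables l t : V.
Hypotheses (lT : forall w, Y l 0 w = T w) (Tt : T t != 0).

Lemma exists_symbol : exists chi : V -> K, forall v w, Y v 0 w = chi v *: T w.
Proof.
have [chi H] := choice (fun v => lowest_mode_scalar simpleA finA (low0 A v)).
by exists chi.
Qed.

(** Writing the zeroth mode of v as chi(v) T, the polynomial
    sum_n (-X)^n / n! chi(v_(n) l) is C[T]-linear in v and vanishes only on
    central vectors: if v_(i) = c T is the lowest mode of v, its coefficient at
    X^(i+1) is a nonzero multiple of c.  Its values form an ideal of C[X], and
    a preimage of a generator generates V modulo central vectors. *)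
Lemma exists_coordinate : exists g (pi : V -> {poly K}),
  [/\ forall w, Y g 0 w = T w, linear pi, forall v, pi (T v) = 'X * pi v,
      forall v, pi v = 0 <-> central v & pi g = 1].
Proof.
have [chi chiE] := exists_symbol.
have chiP v a : (forall w, Y v 0 w = a *: T w) -> chi v = a.
  move=> H; have /eqP := H t; rewrite chiE -subr_eq0 -scalerBl scaler_eq0 (negPf Tt) orbF subr_eq0.
  by move=> /eqP.
have chiL a u v : chi (a *: u + v) = a * chi u + chi v.
  by apply: chiP => w; rewrite modeDl modeZl !chiE scalerA scalerDl.
have chiT v : chi (T v) = 0 by apply: chiP => w; rewrite T_mode_nat0 scale0r.
have chi0 v : central v -> chi v = 0 by move=> cv; apply: chiP => w; rewrite cv scale0r.
have chil : chi l = 1 by apply: chiP => w; rewrite lT scale1r.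
have chi_low i v c : low i v -> (forall w, Y v i w = c *: T w) ->
    chi (Y v i.+1 l) = 2%:R * i.+1%:R * c.
  move=> lv vE; apply: chiP => w; have := mode_commutator_nat v l i.+1 0 w.
  rewrite !lT 2!big_ord_recr /= big1 ?add0r => [|j _]; last by rewrite [Y v j l]lv // mode0l scaler0.
  rewrite subnn subSn // subnn add0n binSn binn scale1r vE modeZl T_mode_nat_succ.
  rewrite mode_Tr_nat vE lT => /addrI H.
  by rewrite -[LHS](addKr (i.+1%:R *: (c *: - (1%:R *: T w)))) -H; lmod_arith V; ring.
have [N NE] := choice (fun v => mode_nat_bounded A v l).
(* The factor turns (T v)_(n+1) = - (n + 1) v_(n) into a shift of coefficients. *)
pose s (n : nat) : K := (-1) ^+ n / (n`!)%:R.
have s0 n : s n != 0 by rewrite mulf_neq0 ?signr_eq0 // invr_eq0 pnatr_eq0 -lt0n fact_gt0.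
have sS n : s n.+1 * - n.+1%:R = s n.
  rewrite /s factS natrM exprS; have := fact_gt0 n; rewrite lt0n.
  rewrite -(pnatr_eq0 K) => nz; have nz' : n.+1%:R != 0 :> K by rewrite pnatr_eq0.
  by move: (n.+1%:R : K) nz' => a a0; field; rewrite a0 nz.
pose Phi v := \poly_(n < N v) (s n * chi (Y v n l)).
have PhiE v n : (Phi v)`_n = s n * chi (Y v n l).
  rewrite coef_poly; case: ltnP => // leN; rewrite NE // chi0 ?mulr0 //.
  exact: central0.
have PhiL a u v : Phi (a *: u + v) = a *: Phi u + Phi v.
  by apply/polyP => n; rewrite coefD coefZ !PhiE modeDl modeZl chiL; ring.
have PhiT v : Phi (T v) = 'X * Phi v.
  apply/polyP => -[|n]; rewrite coefXM !PhiE /=.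
    by rewrite T_mode_nat0 chi0 ?mulr0 //; exact: central0.
  rewrite T_mode_nat_succ -scaleNr -[_ *: _]addr0 chiL [chi 0]chi0 ?addr0; last exact: central0.
  by rewrite mulrA sS.
have Phi0 v : Phi v = 0 <-> central v.
  split=> [Pv|cv]; last first.
    by apply/polyP => n; rewrite PhiE cv chi0 ?mulr0 ?coef0 //; exact: central0.
  apply: contrapT => /noncentral_lowest [i [c [c0 lv vE]]].
  have /eqP := congr1 (fun p : {poly K} => p`_i.+1) Pv.
  rewrite PhiE coef0 (chi_low i v c) //; apply/negP; apply: mulf_neq0; first exact: s0.
  by rewrite !mulf_eq0 !pnatr_eq0 (negPf c0).
have PhiB u v : Phi (u - v) = Phi u - Phi v.
  by rewrite addrC -scaleN1r PhiL scaleN1r addrC.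
have Phip q v : Phi (peval T q v) = q * Phi v.
  elim/poly_ind: q v => [|q c IH] v.
    by rewrite peval0 mul0r; apply/Phi0; exact: central0.
  rewrite pevalD pevalMX pevalC addrC PhiL IH PhiT mulrDl mul_polyC mulrA.
  by rewrite addrC.
have Pl : Phi l != 0.
  apply/eqP => /Phi0 cl; have := chil; rewrite chi0 // => /eqP.
  by rewrite eq_sym oner_eq0.
have exs : exists s, `[< exists v, Phi v != 0 /\ size (Phi v) = s >].
  by exists (size (Phi l)); apply/asboolP; exists l.
case: (ex_minnP exs) => sz /asboolP [g [g0 gsz]] minsz.
have dvd v : Phi g %| Phi v.
  rewrite /dvdp; apply: contraT => r0.
  have rE : Phi (v - peval T (Phi v %/ Phi g) g) = Phi v %% Phi g.
    by rewrite PhiB Phip {1}[Phi v](divp_eq _ (Phi g)) addrC addKr.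
  have : (sz <= size (Phi v %% Phi g)%R)%N.
    apply: minsz; apply/asboolP; exists (v - peval T (Phi v %/ Phi g) g).
    by rewrite rE.
  by rewrite leqNgt -gsz ltn_modp g0.
pose pi0 v := Phi v %/ Phi g.
have pi0E v : Phi v = pi0 v * Phi g by rewrite divpK.
have chip q v : chi (peval T q v) = q`_0 * chi v.
  elim/poly_ind: q v => [|q c _] v.
    by rewrite peval0 coef0 mul0r chi0 //; exact: central0.
  rewrite pevalD pevalMX pevalC peval_comm // addrC chiL chiT addr0.
  by rewrite coefD coefMX coefC /= add0r.
have chig : chi g != 0.
  apply/eqP => cg; have : central (l - peval T (pi0 l) g).
    by apply/Phi0; rewrite PhiB Phip -pi0E subrr.
  move=> /chi0; rewrite addrC -scaleN1r chiL chip cg chil mulr0 mulr0 add0r => /eqP.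
  by rewrite oner_eq0.
exists ((chi g)^-1 *: g), (fun v => chi g *: pi0 v); split.
- by move=> w; rewrite modeZl chiE scalerA mulVf // scale1r.
- move=> a u v; rewrite scalerA mulrC -scalerA -scalerDr; congr (_ *: _).
  by apply: (mulIf g0); rewrite -pi0E mulrDl -scalerAl -!pi0E PhiL.
- move=> v; rewrite -scalerAr; congr (_ *: _).
  by apply: (mulIf g0); rewrite -pi0E -mulrA -pi0E PhiT.
- move=> v; rewrite -Phi0 pi0E; split=> [/eqP|/eqP].
    by rewrite scaler_eq0 (negPf chig) /= => /eqP ->; rewrite mul0r.
  by rewrite mulf_eq0 (negPf g0) orbF => /eqP ->; rewrite scaler0.
apply: (mulIf g0); rewrite mul1r -scalerAl -pi0E.
have := PhiL (chi g)^-1 g 0; rewrite !addr0 => ->.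
have -> : Phi 0 = 0 by apply/Phi0; exact: central0.
by rewrite addr0 scalerA mulfV // scale1r.
Qed.

End Coordinate.

Section ConformalWeight.

Variables (l t : V) (pi : V -> {poly K}).
Hypotheses (lT : forall w, Y l 0 w = T w) (Tt : T t != 0).
Hypotheses (piL : linear pi) (piT : forall v, pi (T v) = 'X * pi v).
Hypotheses (pi0 : forall v, pi v = 0 <-> central v) (pil : pi l = 1).

Let pi_0 : pi 0 = 0. Proof. by apply/pi0; exact: central0. Qed.
Let piD u v : pi (u + v) = pi u + pi v.
Proof. by have := piL 1 u v; rewrite !scale1r. Qed.
Let piZ a u : pi (a *: u) = a *: pi u.
Proof. by have := piL a u 0; rewrite pi_0 !addr0. Qed.
Let piB u v : pi (u - v) = pi u - pi v.
Proof. by rewrite -scaleN1r piD piZ scaleN1r. Qed.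
Let pi_sum (I : Type) (r : seq I) (F : I -> V) : pi (\sum_(i <- r) F i) = \sum_(i <- r) pi (F i).
Proof. by elim/big_rec2: _ => [|i y x _ <-]; rewrite ?pi_0 ?piD. Qed.

Let pi_peval q v : pi (peval T q v) = q * pi v.
Proof.
elim/poly_ind: q v => [|q c IH] v; first by rewrite peval0 mul0r pi_0.
by rewrite pevalD pevalMX pevalC piD piZ IH piT mulrDl mul_polyC mulrA.
Qed.

Let central_pi v : central (v - peval T (pi v) l).
Proof. by apply/pi0; rewrite piB pi_peval pil mulr1 subrr. Qed.

Let p (j : nat) := pi (Y l j l).

(* The rank one form of the rule l_(i) T = T l_(i) + i l_(i-1). *)
Let pi_mode_right (i : nat) v :
  pi (Y l i v) = \sum_(s < i.+1) 'C(i, s)%:R *: ((pi v)^`(s) * p (i - s)).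
Proof.
have vE : v = (v - peval T (pi v) l) + peval T (pi v) l by rewrite subrK.
have -> : pi (Y l i v) = pi (Y l i (peval T (pi v) l)).
  by rewrite {1}vE linearD piD mode_central0 // pi_0 add0r.
move: (pi v) => {vE} q; elim/poly_ind: q i => [|q c IH] i.
  rewrite peval0 linear0 pi_0 big1 // => s _.
  by rewrite derivn_poly0 ?size_poly0 // mul0r scaler0.
rewrite pevalD pevalMX pevalC peval_comm // linearD linearZ /= piD piZ.
case: i => [|i].
  rewrite mode_Tr0 piT IH !big_ord1 bin0 !scale1r !derivn0 subnn.
  by rewrite -mul_polyC -/(p 0); ring.
rewrite mode_Tr_nat piD piZ piT !IH.
rewrite [RHS]big_ord_recl [X in 'X * X]big_ord_recl !bin0 !scale1r !derivn0 subn0.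
under [X in _ = _ + X]eq_bigr => s _ do
  rewrite (_ : lift ord0 s = s.+1 :> nat) // derivnMXaddC subSS.
under [X in 'X * (_ + X)]eq_bigr => s _ do
  rewrite (_ : lift ord0 s = s.+1 :> nat) // subSS.
rewrite (_ : \sum_(s < i.+1) 'C(i.+1, s.+1)%:R *: ((q^`(s) *+ s.+1 + q^`(s.+1) * 'X) * p (i - s))
   = i.+1%:R *: (\sum_(s < i.+1) 'C(i, s)%:R *: (q^`(s) * p (i - s)))
     + 'X * (\sum_(s < i.+1) 'C(i.+1, s.+1)%:R *: (q^`(s.+1) * p (i - s)))); last first.
  rewrite scaler_sumr mulr_sumr -big_split; apply: eq_bigr => s _ /=.
  rewrite mulrDl scalerDr; congr (_ + _).
    by rewrite mulrnAl -[_ *+ s.+1]scaler_nat !scalerA -!natrM (mul_bin_diag i.+1) mulnC.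
  by rewrite -scalerAr; congr (_ *: _); ring.
by rewrite -!mul_polyC -/(p _); ring.
Qed.

Let pi_mode_left M : (forall j, (size (p j) <= M)%N) ->
  forall x (n : nat), (size (pi (Y x n l)) <= M)%N.
Proof.
move=> pM x n; have xE : x = (x - peval T (pi x) l) + peval T (pi x) l by rewrite subrK.
rewrite xE modeDl central_pi add0r; move: (pi x) => {xE} q.
elim/poly_ind: q n => [|q c IH] n; first by rewrite peval0 mode0l pi_0 size_poly0.
rewrite pevalD pevalMX pevalC peval_comm // modeDl modeZl piD piZ.
apply: leq_trans (size_polyD _ _) _; rewrite geq_max; apply/andP; split; last first.
  exact: leq_trans (size_scale_leq _ _) (pM n).
case: n => [|n]; first by rewrite T_mode_nat0 pi_0 size_poly0.
rewrite T_mode_nat_succ -scaleNr piZ.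
exact: leq_trans (size_scale_leq _ _) (IH n).
Qed.

Lemma size_derivn_leq (q : {poly K}) s : (size q^`(s) <= size q - s)%N.
Proof.
apply/leq_sizeP => i; rewrite leq_subLR => le_i.
by rewrite coef_derivn nth_default ?mul0rn.
Qed.

(** The degree of p_j = pi(l_(j) l) is at most one.  If M >= 3 is the maximal
    size of these polynomials, attained first at j, the coefficient of
    X^(2M - 3) in [l_(j+1), l_(j)] l reduces to the one of (j + 1) p_j' p_j,
    while the commutator formula only involves polynomials of size at most M. *)
Let size_p j : (size (p j) <= 2)%N.
Proof.
have [N NE] := mode_nat_bounded A l l.
have pN j' : (N <= j')%N -> p j' = 0 by move=> le; rewrite /p NE // pi_0.
pose M := \max_(j < N) size (p j).
have pM j' : (size (p j') <= M)%N.
  have [lt|/pN ->] := ltnP j' N; last by rewrite size_poly0.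
  exact: (leq_bigmax (Ordinal lt)).
apply: leq_trans (pM j) _; rewrite leqNgt; apply/negP => M3 {j}.
have exj : exists j, size (p j) == M.
  have N0 : (0 < #|'I_N|)%N.
    by rewrite card_ord lt0n; apply: contraTneq M3 => N0; rewrite /M N0 big_ord0.
  by have [j jE] := bigop.eq_bigmax (fun j : 'I_N => size (p j)) N0; exists j; rewrite -jE.
case: (ex_minnP exj) => -[|j] /eqP sj minj.
  by move: M3; rewrite -sj /p lT piT pil mulr1 size_polyX.
have sj' : (size (p j) < M)%N.
  rewrite ltn_neqAle pM andbT; apply/eqP => H.
  by have := minj j; rewrite H eqxx ltnn => /(_ isT).
pose e := (2 * M - 3)%N.
have szM (a b : {poly K}) x y : (size a <= x)%N -> (size b <= y)%N -> (x + y <= e.+1)%N -> (a * b)`_e = 0.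
  move=> ax by_ xy; apply: nth_default; apply: leq_trans (size_polyMleq _ _) _.
  by rewrite /e in xy *; lia.
have tail (i : nat) (q : {poly K}) : (size q <= M)%N ->
    (\sum_(s < i) 'C(i.+1, s.+2)%:R *: (q^`(s.+2) * p (i.-1 - s)))`_e = 0.
  move=> qM; rewrite coef_sum big1 // => s _; rewrite coefZ.
  rewrite (szM _ _ (M - 2)%N M) ?mulr0 //; last by rewrite /e; lia.
  by apply: leq_trans (size_derivn_leq _ _) _; lia.
have rightE (i : nat) v : pi (Y l i.+1 v) = pi v * p i.+1 + i.+1%:R *: ((pi v)^`() * p i)
   + \sum_(s < i) 'C(i.+1, s.+2)%:R *: ((pi v)^`(s.+2) * p (i.-1 - s)).
  rewrite pi_mode_right !big_ord_recl bin0 scale1r derivn0 subn0 -addrA.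
  congr (_ + (_ + _)); first by rewrite (_ : lift ord0 ord0 = 1%N :> nat) // bin1 derivn1 subSS subn0.
  apply: eq_bigr => s _; rewrite (_ : lift ord0 (lift ord0 s) = s.+2 :> nat) //.
  by congr (_ *: (_ * p _)); lia.
have := congr1 (fun u => (pi u)`_e) (mode_commutator_nat l l j.+2 j.+1 l).
rewrite piD [pi (Y l j.+2 (Y _ _ _))]rightE [pi (Y l j.+1 (Y _ _ _))]rightE -!/(p _) !coefD !tail ?pM // !addr0 !coefZ.
rewrite (szM ((p j.+2)^`()) (p j) M.-1 M.-1) ?mulr0 ?addr0; first last.
- by rewrite /e; lia.
- by rewrite -ltnS prednK //; lia.
- by rewrite -derivn1; apply: leq_trans (size_derivn_leq _ _) _; have := pM j.+2; lia.
rewrite [p j.+2 * _]mulrC => /addrI; rewrite [X in _ = X -> _]nth_default; last first.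
  apply: (@leq_trans M); last by rewrite /e; lia.
  rewrite pi_sum; apply: (big_ind (fun q : {poly K} => (size q <= M)%N)).
  - by rewrite size_poly0.
  - by move=> a b aM bM; apply: leq_trans (size_polyD _ _) _; rewrite geq_max aM.
  - move=> s _; rewrite piZ; apply: leq_trans (size_scale_leq _ _) _.
    exact: pi_mode_left.
move/eqP; rewrite mulf_eq0 pnatr_eq0 /= => /eqP pp0.
have p0 : p j.+1 != 0 by rewrite -size_poly_gt0 sj; lia.
(* The derivative of p_j^2 has nonzero leading coefficient, at X^e. *)
have : ((p j.+1 * p j.+1)^`())`_e = 0.
  by rewrite derivM [p j.+1 * _]mulrC coefD pp0 addr0.
rewrite coef_deriv => /eqP; rewrite -mulr_natr mulf_eq0 pnatr_eq0 orbF.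
have -> : e.+1 = (size (p j.+1 * p j.+1)).-1.
  by rewrite size_mul // sj /e; lia.
by rewrite lead_coef_eq0 mulf_eq0 (negPf p0).
Qed.

(** Since l_(1) l = b l + a T l + z with z central, expanding
    [l_(1), l_(1)] = 0 gives a = 0 and b = 2, and l + z / 2 absorbs z. *)
Lemma exists_conformal_vector : exists L, (forall w, Y L 0 w = T w) /\ Y L 1%N L = 2%:R *: L.
Proof.
have /leq_sizeP sp := size_p 1; set a := (p 1)`_1; set b := (p 1)`_0.
have pE : p 1 = a *: 'X + b%:P.
  apply/polyP => -[|[|n]]; rewrite coefD coefZ coefX coefC /= ?mulr0 ?mulr1 ?add0r ?addr0 //.
  exact: sp.
have [z cz lE] : exists2 z, central z & Y l 1%N l = b *: l + a *: T l + z.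
  exists (Y l 1%N l - (b *: l + a *: T l)); last by rewrite [RHS]addrC subrK.
  apply/pi0; rewrite piB piD !piZ piT pil -/(p 1) pE mulr1 alg_polyC.
  by rewrite [b%:P + _]addrC subrr.
have E w : (b - 2%:R) *: Y l 1%N w = a *: T w.
  have := mode_commutator_nat l l 1 1 w; rewrite !big_ord_recr big_ord0 /= add0r.
  rewrite bin0 binn !scale1r lT lE subn0 subnn addn0 addn1.
  rewrite T_mode_nat_succ !modeDl !modeZl T_mode_nat_succ cz lT.
  move=> /eqP; rewrite -subr_eq0 opprD addrA subrr add0r oppr_eq0 => /eqP H.
  by rewrite -[RHS]addr0 -H; lmod_arith V; ring.
have b2 : b = 2%:R.
  have /eqP := E (T t); rewrite mode_Tr_nat lT scalerDr scale1r.
  rewrite -linearZ /= E linearZ /= -subr_eq0 addrAC subrr add0r scaler_eq0 (negPf Tt) orbF subr_eq0.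
  by move=> /eqP.
have a0 : a = 0.
  have /eqP := E t; rewrite b2 subrr scale0r eq_sym scaler_eq0 (negPf Tt) orbF.
  by move=> /eqP.
have Yz k : central (k *: z) by exact: centralZ.
exists (l + 2%:R^-1 *: z); split=> [w|].
  by rewrite modeDl Yz addr0 lT.
rewrite modeDl Yz addr0 linearD [Y l 1%N (_ *: z)]mode_central0 // addr0 lE b2 a0 scale0r addr0.
by rewrite scalerDr scalerA mulfV ?pnatr_eq0 // scale1r.
Qed.

End ConformalWeight.

End Conformal.

(** * Absence of finite Virasoro vertex algebras *)

Section Virasoro.

Variables (R : realType) (V : lmodType R[i]) (A : vertexAlgebra V).

Local Notation K := R[i].
Local Notation Y := (va_prod A).
Local Notation T := (va_T A).
Local Notation central := (central A).
Local Notation low := (low A).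

Hypotheses (simpleA : va_simple A) (finA : va_finite A).

Variables L t : V.
Hypotheses (L0 : forall w, Y L 0 w = T w) (L1 : Y L 1%N L = 2%:R *: L) (Tt : T t != 0).

Let u k := iter k T L.

Let L1_mode a (n : int) b : Y L 1%N (Y a n b) =
  Y (Y L 1%N a) n b + Y a n (Y L 1%N b) - (n + 1)%:~R *: Y a n b.
Proof.
rewrite mode_commutator 2!big_ord_recr big_ord0 /= add0r bin0 binn !scale1r.
rewrite L0 mode_Tl subrr addr0 subr0 addrK mulrNz scaleNr.
by lmod_arith V; ring.
Qed.

(* Bracketing L_(1) with the lowest mode of x shows that a vector of weight h
   can only start at the mode h - 2. *)
Let weight_low x h i : Y L 1%N x = h *: x -> low i x -> h != i.+2%:R -> low i.+1 x.
Proof.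
move=> Hx lx hi; have [c cE] := lowest_mode_scalar simpleA finA lx.
apply: lowS => // w; rewrite cE.
have := L1_mode x i t; rewrite Hx modeZl !cE linearZ /= mode_Tr_nat L0.
have -> : (i%:Z + 1)%:~R = i.+1%:R :> K by rewrite intrD -pmulrn natr1.
rewrite scalerDr scale1r => /eqP; rewrite -subr_eq0.
have -> : c *: T (Y L 1%N t) + c *: T t
     - (h *: (c *: T t) + c *: T (Y L 1%N t) - i.+1%:R *: (c *: T t))
   = (i.+2%:R - h) *: (c *: T t).
  by lmod_arith V; ring.
rewrite !scaler_eq0 subr_eq0 [_ == h]eq_sym (negPf hi) (negPf Tt) orbF => /eqP ->.
by rewrite scale0r.
Qed.

Let weight_central x h i0 : Y L 1%N x = h *: x -> low i0 x ->
  (forall i : nat, (i0 <= i)%N -> h != i.+2%:R) -> central x.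
Proof.
move=> Hx lx hi; apply: low_central => k.
have [le|/ltnW le] := leqP k i0; first exact: lowW lx.
rewrite -(subnKC le); elim: (k - i0)%N => [|j IH]; first by rewrite addn0.
by rewrite addnS; apply: weight_low Hx IH (hi _ (leq_addr _ _)).
Qed.

Let weight_eq0 x h i0 : Y L 1%N x = h *: x -> low i0 x -> h != 0 ->
  (forall i : nat, (i0 <= i)%N -> h != i.+2%:R) -> x = 0.
Proof.
move=> Hx lx h0 hi; have cx := weight_central Hx lx hi.
by have /eqP := Hx; rewrite mode_central0 // eq_sym scaler_eq0 (negPf h0) => /eqP.
Qed.

Let weight_u k : Y L 1%N (u k) = k.+2%:R *: u k.
Proof.
elim: k => [|k IH]; first exact: L1.
by rewrite /u iterS mode_Tr_nat -/(u k) IH L0 linearZ /=; lmod_arith V; ring.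
Qed.

Let u_mode k w : Y (u k) k w = ((-1) ^+ k * (k`!)%:R) *: T w.
Proof. by rewrite /u mode_iterT leqnn subnn ffactnn L0 scalerA. Qed.

Let fact_sign_neq0 k : (-1) ^+ k * (k`!)%:R != 0 :> K.
Proof. by rewrite mulf_neq0 ?signr_eq0 // pnatr_eq0 -lt0n fact_gt0. Qed.

Let u_neq0 k : u k != 0.
Proof.
apply: contraNneq (Tt) => u0; have /eqP := u_mode k t.
by rewrite u0 mode0l eq_sym scaler_eq0 (negPf (fact_sign_neq0 k)).
Qed.

Let low_u k : low k (u k).
Proof. exact: (@low_iterT _ _ A 0 k L (low0 A L)). Qed.

(** Subtracting a suitable multiple of T^k L kills the only mode at which a vector
    of weight k + 2 can start. *)
Let weight_space x k : Y L 1%N x = k.+2%:R *: x -> exists c, x = c *: u k.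
Proof.
move=> Hx; have lx : low k x.
  suff H i : (i <= k)%N -> low i x by exact: H.
  elim: i => // i IH lti; apply: weight_low Hx (IH (ltnW lti)) _.
  by rewrite eqr_nat !eqSS gtn_eqF.
have [c cE] := lowest_mode_scalar simpleA finA lx.
exists (c / ((-1) ^+ k * (k`!)%:R)); apply/eqP; rewrite -subr_eq0; apply/eqP.
apply: (@weight_eq0 _ k.+2%:R k.+1).
- by rewrite linearB /= Hx linearZ /= weight_u; lmod_arith V; ring.
- apply: lowS => [|w]; first by apply: lowB => //; apply: lowZ; exact: low_u.
  by rewrite modeBl modeZl cE u_mode scalerA divfK // subrr.
- by rewrite pnatr_eq0.
- by move=> i lti; rewrite eqr_nat !eqSS ltn_eqF.
Qed.

Let weight_LL (n : int) : Y L 1%N (Y L n L) = (3%:R - n%:~R) *: Y L n L.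
Proof. by rewrite L1_mode L1 modeZl linearZ /= intrD; lmod_arith V; ring. Qed.

Let L2L : Y L 2%N L = 0.
Proof.
have := weight_LL 2%N; rewrite -pmulrn => H.
apply: (weight_eq0 H (low0 A _)); first by rewrite subr_eq0 eqr_nat.
move=> i _; rewrite subr_eq -natrD eqr_nat; lia.
Qed.

Let central_L3L : central (Y L 3%N L).
Proof.
have := weight_LL 3%N; rewrite -pmulrn subrr => H.
by apply: (weight_central H (low0 A _)) => i _; rewrite eq_sym pnatr_eq0.
Qed.

Let L2_comm (n : int) w :
  Y L 2%N (Y L n w) = Y L n (Y L 2%N w) + (2%:R - n%:~R) *: Y L (n + 1) w.
Proof.
rewrite mode_commutator 3!big_ord_recr big_ord0 /= add0r bin0 bin1 L2L mode0l.
rewrite L0 mode_Tl L1 modeZl (_ : n + (2%N%:Z - 0) - 1 = n + 1); last by lia.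
rewrite (_ : n + (2%N%:Z - 1%N%:Z) = n + 1); last by lia.
by rewrite subr0 mulrNz intrD; lmod_arith V; ring.
Qed.

Let L3_comm (n : int) w : Y L 3%N (Y L n w) =
  Y L n (Y L 3%N w) + (3%:R - n%:~R) *: Y L (n + 2) w + Y (Y L 3%N L) n w.
Proof.
rewrite mode_commutator 4!big_ord_recr big_ord0 /= add0r bin0 bin1 binn L2L mode0l.
rewrite L0 mode_Tl L1 modeZl (_ : n + (3%N%:Z - 0) - 1 = n + 2); last by lia.
rewrite (_ : n + (3%N%:Z - 1%N%:Z) = n + 2); last by lia.
rewrite (_ : n + (3%N%:Z - 3%N%:Z) = n); last by lia.
by rewrite subr0 mulrNz intrD; lmod_arith V; ring.
Qed.

(** The one-dimensional weight spaces of weights 4, 5 and 6 give a, b, c with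
    L_(-1) L = a T^2 L, L_(-2) L = b T^3 L, L_(-3) L = c T^4 L.  Applying L_(2)
    yields a = 3/10, b = 1/15, c = 1/84.  Applying L_(3) to the first equation
    determines the action of the central vector L_(3) L, and applying it to the
    third gives 384 c = 36 a - 8, a contradiction. *)
Lemma no_finite_virasoro : False.
Proof.
have scal (a b : K) k : a *: u k = b *: u k -> a = b.
  move=> /eqP; rewrite -subr_eq0 -scalerBl scaler_eq0 (negPf (u_neq0 k)) orbF subr_eq0.
  by move=> /eqP.
have uS k : T (u k) = u k.+1 by [].
have L2T w : Y L 2%N (T w) = T (Y L 2%N w) + 2%:R *: Y L 1%N w by rewrite mode_Tr_nat.
have L3T w : Y L 3%N (T w) = T (Y L 3%N w) + 3%:R *: Y L 2%N w by rewrite mode_Tr_nat.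
have L2u1 : Y L 2%N (u 1) = 4%:R *: u 0.
  by rewrite -uS L2T [Y L _ (u 0)]L2L linear0 weight_u; lmod_arith V; ring.
have L2u2 : Y L 2%N (u 2) = 10%:R *: u 1.
  by rewrite -uS L2T (weight_u 1) L2u1 linearZ /=; lmod_arith V; ring.
have L2u3 : Y L 2%N (u 3) = 18%:R *: u 2.
  by rewrite -uS L2T (weight_u 2) L2u2 linearZ /=; lmod_arith V; ring.
have L2u4 : Y L 2%N (u 4) = 28%:R *: u 3.
  by rewrite -uS L2T (weight_u 3) L2u3 linearZ /=; lmod_arith V; ring.
set z := Y L 3%N L; have cz : central z := central_L3L.
have Tz : T z = 0 by rewrite -L0 mode_central0.
have L3u1 : Y L 3%N (u 1) = 0.
  by rewrite -uS L3T [Y L 2%N (u 0)]L2L -/z Tz scaler0 addr0.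
have L3u2 : Y L 3%N (u 2) = 12%:R *: u 0.
  by rewrite -uS L3T L3u1 L2u1 linear0; lmod_arith V; ring.
have L3u3 : Y L 3%N (u 3) = 42%:R *: u 1.
  by rewrite -uS L3T L3u2 L2u2 linearZ /=; lmod_arith V; ring.
have L3u4 : Y L 3%N (u 4) = 96%:R *: u 2.
  by rewrite -uS L3T L3u3 L2u3 linearZ /=; lmod_arith V; ring.
have [a aE] : exists a, Y L (-1) L = a *: u 2.
  by apply: weight_space; rewrite weight_LL; congr (_ *: _); ring.
have [b bE] : exists b, Y L (-2) L = b *: u 3.
  by apply: weight_space; rewrite weight_LL; congr (_ *: _); ring.
have [c cE] : exists c, Y L (-3) L = c *: u 4.
  by apply: weight_space; rewrite weight_LL; congr (_ *: _); ring.
have Ea : 10%:R * a = 3%:R.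
  apply: (scal _ _ 1%N); have := L2_comm (-1) L.
  rewrite aE L2L linear0 linearZ /= L2u2 L0 => H.
  by rewrite mulrC -scalerA H; lmod_arith V; ring.
have Eb : 18%:R * b = 4%:R * a.
  apply: (scal _ _ 2%N); have := L2_comm (-2) L.
  rewrite bE L2L linear0 linearZ /= L2u3 aE => H.
  by rewrite mulrC -scalerA H; lmod_arith V; ring.
have Ec : 28%:R * c = 5%:R * b.
  apply: (scal _ _ 3%N); have := L2_comm (-3) L.
  rewrite cE L2L linear0 linearZ /= L2u4 bE => H.
  by rewrite mulrC -scalerA H; lmod_arith V; ring.
pose y := Y L (-1) z.
have yE : Y z (-1) L = y by rewrite /y [RHS]mode_central // va_vacR.
have Ey : 2%:R *: y = (12%:R * a - 8%:R) *: u 0.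
  have := L3_comm (-1) L; rewrite aE linearZ /= L3u2 -/z yE -/y L1 => H.
  rewrite scalerBl mulrC -scalerA H -/(u 0); lmod_arith V; ring.
have Yz3 : Y z (-3) L = 0.
  have := mode_Tl A z (-2) L; rewrite Tz mode0l => /esym/eqP.
  by rewrite scaler_eq0 intr_eq0 /= => /eqP.
have ET : T (T y) = 2%:R *: Y L (-3) z.
  have TY (n : int) : T (Y L n z) = (- n)%:~R *: Y L (n - 1) z.
    by rewrite T_mode Tz linear0 add0r mode_Tl.
  by rewrite /y TY scale1r TY.
have := L3_comm (-3) L; rewrite cE linearZ /= L3u4 -/z Yz3 addr0 aE => H.
have E : 384%:R * c = 36%:R * a - 8%:R.
  apply: (scal _ _ 2%N).
  have TTy : 2%:R *: T (T y) = (12%:R * a - 8%:R) *: u 2.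
    by rewrite -linearZ /= -linearZ /= Ey !linearZ.
  transitivity (2%:R *: (2%:R *: (c *: (96%:R *: u 2)))).
    by lmod_arith V; ring.
  rewrite H; transitivity (2%:R *: (2%:R *: Y L (-3) z) + (24%:R * a) *: u 2).
    by lmod_arith V; ring.
  by rewrite -ET TTy; lmod_arith V; ring.
have {}Ea : a = 3%:R / 10%:R by rewrite -Ea; field.
have {}Eb : b = 4%:R * a / 18%:R by rewrite -Eb; field.
have {}Ec : c = 5%:R * b / 28%:R by rewrite -Ec; field.
move/eqP: E; rewrite Ec Eb Ea -subr_eq0.
have -> : 384%:R * (5%:R * (4%:R * (3%:R / 10%:R) / 18%:R) / 28%:R)
  - (36%:R * (3%:R / 10%:R) - 8%:R) = 62%:R / 35%:R :> K by field.
by rewrite mulf_eq0 invr_eq0 !pnatr_eq0.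
Qed.

End Virasoro.

(** * Commutativity *)

Theorem theorem3p2 (R : realType) (V : lmodType R[i]) (A : vertexAlgebra V) :
  va_finite A -> va_simple A -> va_commutative A.
Proof.
move=> finA simpleA; apply: contrapT => nC.
have [l [t [lT Tt]]] := exists_translation_vector simpleA finA nC.
have [g [pi [gT piL piT pi0 pig]]] := exists_coordinate simpleA finA lT Tt.
have [L [LT LL]] := exists_conformal_vector gT Tt piL piT pi0 pig.
by case: (no_finite_virasoro simpleA finA LT LL Tt).
Qed.
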